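(* Let $S$ be an inverse semigroup. Suppose that $\mathcal{X}$ is a closed invariant subset of $\widehat{E(S)}$. Then the quotient $\mathrm{B}(S)/\!\sim_{\mathcal{X}}$ is isomorphic to $\mathrm{B}_{X_{\pi_{\mathcal X}}}(S)$, where $\pi_{\mathcal X}\colon S\to \mathrm{B}(S)/\!\sim_{\mathcal X}$ is the composition of $\iota_{\mathrm{B}(S)}\colon S\to \mathrm{B}(S)$ and the quotient map $\mathrm{B}(S)\to \mathrm{B}(S)/\!\sim_{\mathcal X}$.
   Context: Conventions. All inverse semigroups have a zero element $0$. For an inverse semigroup $S$, $E(S)$ is its semilattice of idempotents ($e\wedge f=ef$); $\mathbf{d}(a)=a^{-1}a$; the natural partial order is $a\le b$ iff $a=be$ for some $e\in E(S)$; $a\sim b$ (compatible) means that $a^{-1}b$ and $ab^{-1}$ are idempotents. ''Boolean algebra'' means generalized Boolean algebra (relatively complemented distributive lattice with bottom $0$). A Boolean inverse semigroup is an inverse semigroup $S$ such that $E(S)$ is a Boolean algebra and compatible pairs have joins in the natural partial order. $\mathcal{P}_{fin}(E)$ is the set of all finite subsets of $E$; an empty join is $0$. Characters. A character of a semilattice $E$ is a non-zero map $\varphi\colon E\to\{0,1\}$ with $\varphi(0)=0$ and $\varphi(x\wedge y)=\varphi(x)\wedge\varphi(y)$. $\widehat{E}$ is the set of characters with the topology of pointwise convergence (subspace of $\{0,1\}^E$). For $X\subseteq E\times\mathcal{P}_{fin}(E)$, $\widehat{E}_X$ is the closed subset of characters with $\varphi(e)=\bigvee_{i=1}^n\varphi(e_i)$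 for all $(e,\{e_1,\dots,e_n\})\in X$. $S$ acts on $\widehat{E(S)}$: the domain of $s$ is $\{\varphi:\varphi(\mathbf{d}(s))=1\}$ and $(s\cdot\varphi)(e)=\varphi(s^{-1}es)$. A subset $\mathcal{X}\subseteq\widehat{E(S)}$ is invariant if $s\cdot\varphi\in\mathcal{X}$ whenever $\varphi\in\mathcal{X}$, $s\in S$ and $\varphi(\mathbf{d}(s))=1$. Booleanizations. $X\subseteq E(S)\times\mathcal{P}_{fin}(E(S))$ is $S$-invariant if $(e,\{e_1,\dots,e_n\})\in X$ implies $(s^{-1}es,\{s^{-1}e_1s,\dots,s^{-1}e_ns\})\in X$ for all $s\in S$; $X'$ is the smallest $S$-invariant subset containing $X$. The set $\widehat{E(S)}_{X'}$ is closed and invariant. $\mathcal{G}_X(S)$ is the groupoid of germs of the restricted action on $\widehat{E(S)}_{X'}$: its elements are the classes $[s,\varphi]$, $s\in S$, $\varphi\in\widehat{E(S)}_{X'}$, $\varphi(\mathbf{d}(s))=1$, where $[s,\varphi]=[t,\varphi]$ iff $se=te$ for some $e\in E(S)$ with $\varphi(e)=1$; $[s,\varphi]$ is an arrow from $\varphi$ to $s\cdot\varphi$, with $[s,t\cdot\varphi][t,\varphi]=[st,\varphi]$. Its topology has as basis the sets $\{[s,\varphi]:\varphi(\mathbf{d}(s))=1,\ \varphi(\mathbf{d}(s_1))=\dots=\varphi(\mathbf{d}(s_n))=0\}$, where $n\ge0$, $s\in S$, $s_1,\dots,s_n\le s$. $\mathrm{B}_X(S)$ is the Boolean inverse semigroup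 of compact-open bisections of $\mathcal{G}_X(S)$ under multiplication of subsets. For $X=\varnothing$ one writes $\mathcal{G}(S)$ and $\mathrm{B}(S)$ (the Booleanization of $S$; here $\widehat{E(S)}_{X'}=\widehat{E(S)}$); $\iota_{\mathrm{B}(S)}(s)=\{[s,\varphi]\in\mathcal{G}(S):\varphi(\mathbf{d}(s))=1\}$. $E(\mathrm{B}(S))$ is identified with the Boolean algebra of compact-open subsets of $\widehat{E(S)}$. The congruence $\sim_{\mathcal{X}}$. Let $I_{\mathcal{X}}$ be the ideal of $E(\mathrm{B}(S))$ consisting of those compact-open subsets of $\widehat{E(S)}$ that do not intersect $\mathcal{X}$. For $a,b\in\mathrm{B}(S)$, $a\sim_{\mathcal{X}}b$ iff there are $e,f,g\in E(\mathrm{B}(S))$ with $\mathbf{d}(a)=e\vee f$, $\mathbf{d}(b)=e\vee g$, $f,g\in I_{\mathcal{X}}$ and $ae=be$. This is a congruence and the quotient $\mathrm{B}(S)/\!\sim_{\mathcal{X}}$ is a Boolean inverse semigroup. The set $X_\pi$. For a semigroup morphism $\pi\colon S\to T$ to a Boolean inverse semigroup $T$ with $\pi(0)=0$, $X_{\pi}$ is the set of all $(e,\{e_1,\dots,e_n\})\in E(S)\times\mathcal{P}_{fin}(E(S))$ such that $\pi(e)=\bigvee_{i=1}^n\pi(e_i)$ in $E(T)$. *)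

(* Defs.v *)
From HB Require Import structures.
From mathcomp Require Import all_boot monoid finmap all_classical.
From mathcomp Require Import topology function_spaces.

Set Implicit Arguments.
Unset Strict Implicit.
Unset Printing Implicit Defensive.

Local Open Scope classical_set_scope.
Local Open Scope group_scope.
Local Open Scope quotient_scope.

HB.mixin Record Semigroup_isInverse S of Semigroup S := {
  sinv : S -> S;
  szero : S;
  mulsVs : forall x : S, mul (mul x (sinv x)) x = x;
  mulVsV : forall x : S, mul (mul (sinv x) x) (sinv x) = sinv x;
  sinv_unique : forall x y : S,
    mul (mul x y) x = x -> mul (mul y x) y = y -> y = sinv x;
  mul0s : forall x : S, mul szero x = szero;
  muls0 : forall x : S, mul x szero = szero
}.

#[short(type="invSemigroupType")]
HB.structure Definition InvSemigroup :=
  {S of Semigroup_isInverse S & Semigroup S}.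

Bind Scope group_scope with InvSemigroup.sort.

Local Notation "x ^-1" := (sinv x) : group_scope.
Local Notation "0" := (@szero _) : group_scope.

Section InvSemigroupTheory.
Context {S : invSemigroupType}.
Implicit Types a b e f x y : S.

Definition idempotent e : Prop := e * e = e.

Lemma sinvK x : x^-1^-1 = x.
Proof. by apply: esym; apply: sinv_unique; [exact: mulVsV | exact: mulsVs]. Qed.

Lemma sinv_idem e : idempotent e -> e^-1 = e.
Proof. by move=> he; apply: esym; apply: sinv_unique; rewrite he he. Qed.

Lemma idemM e f : idempotent e -> idempotent f -> idempotent (e * f).
Proof.
move=> he hf; set x := (e * f)^-1.
have fxe : f * x * e = x.
  apply: sinv_unique.
    have -> : e * f * (f * x * e) * (e * f) = (e * (f * f)) * x * ((e * e) * f).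
      by rewrite !mulgA.
    by rewrite he hf mulsVs.
  have -> : f * x * e * (e * f) * (f * x * e) =
            f * (x * ((e * e) * (f * f)) * x) * e by rewrite !mulgA.
  by rewrite he hf mulVsV.
have hx : idempotent x.
  rewrite /idempotent -{1 2}fxe.
  have -> : f * x * e * (f * x * e) = f * (x * (e * f) * x) * e.
    by rewrite !mulgA.
  by rewrite mulVsV.
by rewrite -[e * f]sinvK -/x (sinv_idem hx).
Qed.

Lemma idemC e f : idempotent e -> idempotent f -> e * f = f * e.
Proof.
move=> he hf; have hef := idemM he hf; have hfe := idemM hf he.
rewrite -[LHS](sinv_idem hef); apply: esym; apply: sinv_unique.
  have -> : e * f * (f * e) * (e * f) = e * (f * f) * ((e * e) * f).
    by rewrite !mulgA.
  by rewrite he hf mulgA -mulgA in hef *; rewrite ?hef // mulgA hef.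
have -> : f * e * (e * f) * (f * e) = f * (e * e) * ((f * f) * e).
  by rewrite !mulgA.
by rewrite he hf mulgA -mulgA in hfe *; rewrite ?hfe // mulgA hfe.
Qed.

Lemma idemVM x : idempotent (x^-1 * x).
Proof. by rewrite /idempotent mulgA mulVsV. Qed.

Lemma idemMV x : idempotent (x * x^-1).
Proof. by rewrite /idempotent mulgA mulsVs. Qed.

Lemma sinvM x y : (x * y)^-1 = y^-1 * x^-1.
Proof.
have c := idemC (idemMV y) (idemVM x).
apply: esym; apply: sinv_unique.
  have -> : x * y * (y^-1 * x^-1) * (x * y) =
            x * ((y * y^-1) * (x^-1 * x)) * y by rewrite !mulgA.
  by rewrite c !mulgA mulsVs -!mulgA [y * _]mulgA mulsVs.
have -> : y^-1 * x^-1 * (x * y) * (y^-1 * x^-1) =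
          y^-1 * ((x^-1 * x) * (y * y^-1)) * x^-1 by rewrite !mulgA.
by rewrite -c !mulgA mulVsV -!mulgA [x^-1 * (x * _)]mulgA mulVsV.
Qed.

Lemma idem0 : idempotent (0 : S).
Proof. exact: mul0s. Qed.

Lemma idemJ x e : idempotent e -> idempotent (x^-1 * e * x).
Proof.
move=> he; rewrite /idempotent.
have -> : x^-1 * e * x * (x^-1 * e * x) = x^-1 * (e * ((x * x^-1) * e)) * x.
  by rewrite !mulgA.
rewrite (idemC (idemMV x) he) [e * (e * _)]mulgA he.
by rewrite (idemC he (idemMV x)) !mulgA mulVsV.
Qed.

(* The natural partial order. *)
Definition nle a b : Prop := exists2 e, idempotent e & a = b * e.

(* [x] is the join of [A] in the semilattice of idempotents. *)
Definition idem_join (A : set S) x : Prop :=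
  [/\ idempotent x,
      forall a, A a -> nle a x &
      forall y, idempotent y -> (forall a, A a -> nle a y) -> nle x y].

Lemma idem_nle e f : idempotent e -> idempotent f -> nle e f <-> e = f * e.
Proof.
move=> he hf; split=> [[g hg ->]|->]; first by rewrite mulgA hf.
by exists e.
Qed.

End InvSemigroupTheory.

Definition idem (S : invSemigroupType) := {e : S | `[< idempotent e >]}.

HB.instance Definition _ S := SubType.on (idem S).
HB.instance Definition _ S := Choice.on (idem S).

Section Idempotents.
Context {S : invSemigroupType}.
Implicit Types (s t : S) (e f : idem S).

Definition Idem (x : S) (hx : idempotent x) : idem S :=
  exist _ x (introT (asboolP _) hx).

Lemma idem_valP e : idempotent (val e).
Proof. by case: e => x /= /asboolP. Qed.

Definition imeet e f : idem S := Idem (idemM (idem_valP e) (idem_valP f)).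
Definition izero : idem S := Idem idem0.
(* [dd s] is d(s); [iconj s e] is s^-1 e s. *)
Definition dd s : idem S := Idem (idemVM s).
Definition iconj s e : idem S := Idem (idemJ s (idem_valP e)).

Lemma ival_inj e f : val e = val f -> e = f. Proof. exact: val_inj. Qed.

Lemma iconj0 s : iconj s izero = izero.
Proof. by apply: val_inj; rewrite /= muls0 mul0s. Qed.

Lemma iconjI s e f : iconj s (imeet e f) = imeet (iconj s e) (iconj s f).
Proof.
apply: val_inj => /=.
have -> : s^-1 * val e * s * (s^-1 * val f * s) =
          s^-1 * (val e * (s * s^-1)) * val f * s by rewrite !mulgA.
by rewrite (idemC (idem_valP e) (idemMV s)) !mulgA mulVsV.
Qed.

Lemma iconjd s : iconj s (dd s^-1) = dd s.
Proof. by apply: val_inj; rewrite /= sinvK !mulgA mulVsV. Qed.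

Lemma iconjM s t e : iconj t (iconj s e) = iconj (s * t) e.
Proof. by apply: val_inj; rewrite /= sinvM !mulgA. Qed.

Lemma ddM s t : dd (s * t) = iconj t (dd s).
Proof. by apply: val_inj; rewrite /= sinvM !mulgA. Qed.

Lemma ddI s e : dd (s * val e) = imeet (dd s) e.
Proof.
apply: val_inj; rewrite /= sinvM (sinv_idem (idem_valP e)).
have -> : val e * s^-1 * (s * val e) = val e * (s^-1 * s) * val e.
  by rewrite !mulgA.
by rewrite (idemC (idem_valP e) (idemVM s)) -mulgA idem_valP.
Qed.

Lemma imeetC e f : imeet e f = imeet f e.
Proof. by apply: val_inj; apply: idemC; exact: idem_valP. Qed.

Lemma mul_dd s : s * val (dd s) = s. Proof. by rewrite /= mulgA mulsVs. Qed.

Lemma mulsC_idem s e : val e * s = s * val (iconj s e).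
Proof.
rewrite /=; have -> : s * (s^-1 * val e * s) = (s * s^-1) * val e * s.
  by rewrite !mulgA.
by rewrite (idemC (idemMV s) (idem_valP e)) -mulgA mulsVs.
Qed.

End Idempotents.

Record character (S : invSemigroupType) := Character {
  char_fun :> idem S -> bool;
  char_neq0 : exists e, char_fun e;
  char0 : char_fun izero = false;
  charI : forall e f, char_fun (imeet e f) = char_fun e && char_fun f
}.

HB.instance Definition _ S := gen_eqMixin (character S).
HB.instance Definition _ S := gen_choiceMixin (character S).
(* {0,1}^E carries the product topology of discrete copies of [bool]. *)
HB.instance Definition _ S := Topological.copy (character S)
  (initial_topology (@char_fun S : character S -> {ptws idem S -> bool})).

Section Characters.
Context {S : invSemigroupType}.
Implicit Types (s t : S) (e f : idem S) (phi psi : character S).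

Lemma char_ext phi psi : (forall e, phi e = psi e) -> phi = psi.
Proof.
case: phi psi => p p1 p2 p3 [q q1 q2 q3] /= /funext epq; subst q.
by congr Character; exact: Prop_irrelevance.
Qed.

Lemma act_neq0 s phi : phi (dd s) -> exists e, phi (iconj s e).
Proof. by exists (dd s^-1); rewrite iconjd. Qed.

Lemma act_char0 s phi : phi (iconj s izero) = false.
Proof. by rewrite iconj0 char0. Qed.

Lemma act_charI s phi e f :
  phi (iconj s (imeet e f)) = phi (iconj s e) && phi (iconj s f).
Proof. by rewrite iconjI charI. Qed.

Definition act s phi (h : phi (dd s)) : character S :=
  @Character S (fun e => phi (iconj s e)) (act_neq0 h)
    (act_char0 s phi) (act_charI s phi).

Definition invariant (Y : set (character S)) : Prop :=
  forall s phi (h : phi (dd s)), Y phi -> Y (act h).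

End Characters.

Section Relations.
Context {S : invSemigroupType}.
Implicit Type X : set (idem S * {fset idem S}).

Definition S_invariant X : Prop := forall e F, X (e, F) ->
  forall s, X (iconj s e, [fset iconj s f | f in F]%fset).

Definition inv_closure X := smallest S_invariant X.

Definition spectrum X : set (character S) :=
  [set phi | forall e F, X (e, F) -> phi e = \big[orb/false]_(f <- F) phi f].

End Relations.

(* [PreGerm s phi _ _] represents the germ [s, phi]. *)
Record pregerm (S : invSemigroupType) (Y : set (character S)) := PreGerm {
  pg_elt : S;
  pg_char : character S;
  pg_in : Y pg_char;
  pg_dom : pg_char (dd pg_elt)
}.

HB.instance Definition _ S Y := gen_eqMixin (@pregerm S Y).
HB.instance Definition _ S Y := gen_choiceMixin (@pregerm S Y).

Section Germs.
Context {S : invSemigroupType} {Y : set (character S)}.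
Implicit Types p q r : pregerm Y.

Definition pg_eq p q : Prop := pg_char p = pg_char q /\
  exists2 e : idem S, pg_char p e & pg_elt p * val e = pg_elt q * val e.

Lemma pg_eq_equiv : equiv_class_of (fun p q => `[< pg_eq p q >]).
Proof.
split.
- by move=> p; apply/asboolP; split=> //; exists (dd (pg_elt p)) => //; exact: pg_dom.
- move=> p q; apply/asboolP/asboolP => -[e1 [e h1 h2]]; split=> //; exists e => //; by rewrite -?e1 // e1.
- move=> q p r /asboolP[e1 [e he ee]] /asboolP[e2 [f hf ef]].
  apply/asboolP; split; first by rewrite e1.
  exists (imeet e f); first by rewrite charI he e1 hf.
  rewrite /= mulgA ee -mulgA (idemC (idem_valP e) (idem_valP f)).
  by rewrite mulgA ef -mulgA.
Qed.

Canonical pg_equiv := EquivRelPack pg_eq_equiv.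

End Germs.

Definition germ (S : invSemigroupType) (Y : set (character S)) :=
  {eq_quot @pg_equiv S Y}.

HB.instance Definition _ S Y := Choice.on (@germ S Y).
HB.instance Definition _ S Y := EqQuotient.on (@germ S Y).

Section GermGroupoid.
Context {S : invSemigroupType} {Y : set (character S)}.
Implicit Types (p q r : pregerm Y) (g h k x y z : germ Y) (U V W : set (germ Y)).

Definition mkgerm p : germ Y := \pi_(germ Y) p.

Definition pg_act p : character S := act (pg_dom p).

Definition gdom g : character S := pg_char (repr g).
Definition gcod g : character S := pg_act (repr g).

(* [germ_comp g h k]: the product [g h] is defined and equals [k]; that is,
   [s, t phi] [t, phi] = [s t, phi]. *)
Definition germ_comp g h k : Prop := exists p q r,
  [/\ g = mkgerm p, h = mkgerm q & k = mkgerm r] /\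
  [/\ pg_char p = pg_act q, pg_char r = pg_char q &
      pg_elt r = pg_elt p * pg_elt q].

(* [germ_inv g h]: [h] is the inverse [s^-1, s phi] of [g = [s, phi]]. *)
Definition germ_inv g h : Prop := exists p q,
  [/\ g = mkgerm p, h = mkgerm q, pg_char q = pg_act p &
      pg_elt q = (pg_elt p)^-1].

Definition germ_mul U V : set (germ Y) :=
  [set k | exists g h, [/\ U g, V h & germ_comp g h k]].

Definition germ_setinv U : set (germ Y) :=
  [set h | exists2 g, U g & germ_inv g h].

Definition bisection U : Prop := set_inj U gdom /\ set_inj U gcod.

Definition germ_basic (s : S) (l : seq S) : set (germ Y) :=
  [set g | exists p, [/\ g = mkgerm p, pg_elt p = s &
                         forall t, t \in l -> ~~ pg_char p (dd t)]].

Lemma mkgermP p q : mkgerm p = mkgerm q <-> pg_eq p q.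
Proof.
by split => [/eqmodP/asboolP//|h]; apply/eqmodP/asboolP.
Qed.

Lemma germW (P : germ Y -> Prop) : (forall p, P (mkgerm p)) -> forall g, P g.
Proof. by move=> h g; rewrite -[g]reprK; exact: h. Qed.

Lemma pg_ext p q : pg_char p = pg_char q -> pg_elt p = pg_elt q ->
  mkgerm p = mkgerm q.
Proof.
move=> e1 e2; apply/mkgermP; split=> //; exists (dd (pg_elt p)); last by rewrite e2.
exact: pg_dom.
Qed.

Lemma iconj_idem (s : S) (e f : idem S) :
  iconj (s * val e) f = imeet (iconj s f) e.
Proof.
apply: val_inj; rewrite /= sinvM (sinv_idem (idem_valP e)).
have c := idemC (idem_valP e) (idem_valP (iconj s f)).
have -> : val e * s^-1 * val f * (s * val e) =
  (val e * val (iconj s f)) * val e by rewrite /= !mulgA.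
by rewrite c -mulgA idem_valP.
Qed.

Lemma pg_act_eq p q : pg_eq p q -> pg_act p = pg_act q.
Proof.
move=> [e1 [e he ee]]; apply: char_ext => f /=.
have <- : pg_char p (iconj (pg_elt p * val e) f) = pg_char p (iconj (pg_elt p) f).
  by rewrite iconj_idem charI he andbT.
by rewrite ee iconj_idem charI he andbT e1.
Qed.

Lemma gdomE p : gdom (mkgerm p) = pg_char p.
Proof. by have /mkgermP[] : mkgerm (repr (mkgerm p)) = mkgerm p := reprK _. Qed.

Lemma gcodE p : gcod (mkgerm p) = pg_act p.
Proof. by apply/pg_act_eq/mkgermP; exact: reprK. Qed.

Lemma pg_mul_dom p q : pg_char p = pg_act q ->
  pg_char q (dd (pg_elt p * pg_elt q)).
Proof. by move=> e; have := pg_dom p; rewrite e ddM. Qed.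

Definition pg_mul p q (e : pg_char p = pg_act q) : pregerm Y :=
  PreGerm (pg_in q) (pg_mul_dom e).

Lemma comp_mk p q (e : pg_char p = pg_act q) :
  germ_comp (mkgerm p) (mkgerm q) (mkgerm (pg_mul e)).
Proof. by exists p, q, (pg_mul e). Qed.

Lemma comp_mkP p q k : germ_comp (mkgerm p) (mkgerm q) k ->
  exists e : pg_char p = pg_act q, k = mkgerm (pg_mul e).
Proof.
move=> [p' [q' [r' [[/mkgermP ep /mkgermP eq ->] [e1 e2 e3]]]]].
have e : pg_char p = pg_act q by rewrite ep.1 e1 -(pg_act_eq eq).
exists e; apply/mkgermP; split; first by rewrite e2 -eq.1.
have [epc [f hf ef]] := ep; have [eqc [f' hf' ef']] := eq.
exists (imeet f' (iconj (pg_elt q) f)).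
  by rewrite charI e2 -eqc hf' /=; move: hf; rewrite e.
have -> : val (imeet f' (iconj (pg_elt q) f)) = val f' * val (iconj (pg_elt q) f).
  by [].
apply: esym; rewrite [pg_elt (pg_mul e)]/= e3.
have -> : pg_elt p * pg_elt q * (val f' * val (iconj (pg_elt q) f)) =
          pg_elt p * (pg_elt q * val (iconj (pg_elt q) f)) * val f'.
  by rewrite (idemC (idem_valP f') (idem_valP _)) !mulgA.
rewrite -mulsC_idem [X in X * _ = _]mulgA ef.
rewrite -[_ * val f * _]mulgA (mulsC_idem (pg_elt q) f).
have -> : pg_elt p' * (pg_elt q * val (iconj (pg_elt q) f)) * val f' =
    pg_elt p' * (pg_elt q * (val f' * val (iconj (pg_elt q) f))).
  by rewrite (idemC (idem_valP f') (idem_valP _)) !mulgA.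
by rewrite [pg_elt q * _]mulgA ef' !mulgA.
Qed.

Lemma comp_dom g h k : germ_comp g h k ->
  [/\ gdom g = gcod h, gdom k = gdom h & gcod k = gcod g].
Proof.
elim/germW: g => p; elim/germW: h => q /comp_mkP[e ->]; rewrite !gdomE !gcodE.
split=> //; apply: char_ext => f /=.
by rewrite -iconjM; have := congr1 (fun c : character S => c (iconj (pg_elt p) f)) e.
Qed.

Lemma comp_ex g h : gdom g = gcod h -> exists k, germ_comp g h k.
Proof.
elim/germW: g => p; elim/germW: h => q; rewrite gdomE gcodE => e.
by exists (mkgerm (pg_mul e)); exact: comp_mk.
Qed.

Lemma comp_fun g h k k' : germ_comp g h k -> germ_comp g h k' -> k = k'.
Proof.
elim/germW: g => p; elim/germW: h => q /comp_mkP[e ->] /comp_mkP[e' ->].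
exact: pg_ext.
Qed.

Lemma compA g h k x y :
  germ_comp g h x -> germ_comp x k y ->
  exists2 z, germ_comp h k z & germ_comp g z y.
Proof.
move=> c1 c2; have [d1 d2 d3] := comp_dom c1; have [d4 d5 d6] := comp_dom c2.
have [z c3] := @comp_ex h k ltac:(by rewrite -d2 d4); exists z => //.
have [d7 d8 d9] := comp_dom c3.
have [y' c4] := @comp_ex g z ltac:(by rewrite d1 d9).
suff -> : y = y' by [].
move: g h k c1 c2 c3 c4 {d1 d2 d3 d4 d5 d6 d7 d8 d9}.
apply: germW => p; apply: germW => q; apply: germW => r.
move=> /comp_mkP[e1 ->] /comp_mkP[e2 ->] /comp_mkP[e3 ->] /comp_mkP[e4 ->].
by apply: pg_ext => //=; rewrite mulgA.
Qed.

Lemma compA' g h k z y :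
  germ_comp h k z -> germ_comp g z y ->
  exists2 x, germ_comp g h x & germ_comp x k y.
Proof.
move=> c1 c2; have [d1 d2 d3] := comp_dom c1; have [d4 d5 d6] := comp_dom c2.
have [x c3] := @comp_ex g h ltac:(by rewrite d4 d3).
have [d7 d8 d9] := comp_dom c3.
have [y' c4] := @comp_ex x k ltac:(by rewrite d8 d1).
exists x => //; have [z' c5 c6] := compA c3 c4.
by rewrite -(comp_fun c1 c5) in c6; rewrite (comp_fun c2 c6).
Qed.

Lemma inv_sym g h : germ_inv g h -> germ_inv h g.
Proof.
move=> [p [q [-> -> e1 e2]]]; exists q, p; split=> //; last by rewrite e2 sinvK.
apply: char_ext => f /=; rewrite e2 e1 /= iconjM.
have -> : iconj ((pg_elt p)^-1 * pg_elt p) f = imeet f (dd (pg_elt p)).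
  apply: val_inj; rewrite /= (sinv_idem (idemVM _)).
  rewrite -mulgA (idemC (idem_valP f) (idemVM _)).
  by rewrite [in LHS]mulgA idemVM.
by rewrite charI pg_dom andbT.
Qed.

Lemma inv_dom g h : germ_inv g h -> gdom h = gcod g.
Proof. by move=> [p [q [-> -> e1 e2]]]; rewrite gdomE gcodE. Qed.

Lemma inv_cod g h : germ_inv g h -> gcod h = gdom g.
Proof. by move=> /inv_sym/inv_dom. Qed.

Lemma comp_Kl g g' h k : germ_comp g h k -> germ_inv g g' -> germ_comp g' k h.
Proof.
move=> c [p [p' [eg -> e1 e2]]]; move: c; rewrite eg; elim/germW: h => q /comp_mkP[e ->].
have e' : pg_char p' = pg_act (pg_mul e).
  have [_ _] := comp_dom (comp_mk e); rewrite !gcodE => ->; exact: e1.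
suff -> : mkgerm q = mkgerm (pg_mul e') by exact: comp_mk.
apply/mkgermP; split=> //=; exists (iconj (pg_elt q) (dd (pg_elt p))).
  by have := pg_dom p; rewrite e.
by rewrite e2 -!mulgA -!mulsC_idem /= ![in RHS]mulgA mulVsV.
Qed.

Lemma comp_Kr g h h' k : germ_comp g h k -> germ_inv h h' -> germ_comp k h' g.
Proof.
move=> c [q [q' [eh -> e1 e2]]]; move: c; rewrite eh; elim/germW: g => p /comp_mkP[e ->].
have e' : pg_char (pg_mul e) = pg_act q'.
  by have [] := inv_sym (ex_intro _ q (ex_intro _ q' (And4 erefl erefl e1 e2))) => p0 [q0 [/mkgermP/pg_act_eq h1 /mkgermP[h2 _] h3 _]]; rewrite /= h1 -h3.
suff -> : mkgerm p = mkgerm (pg_mul e') by exact: comp_mk.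
apply/mkgermP; split=> /=; first by rewrite e1.
exists (dd (pg_elt q')); first by rewrite e -e1 pg_dom.
by rewrite /= e2 sinvK -!mulgA [_^-1 * (_ * _)]mulgA mulVsV.
Qed.

End GermGroupoid.

Arguments germW [S Y] P _ g.

Section GermBasis.
Context {S : invSemigroupType} {Y : set (character S)}.
Implicit Types (p q : pregerm Y) (g : germ Y).

(* The basic open sets [{[s, phi] : phi(d(s)) = 1, phi(d(s_i)) = 0}], where the
   [s_i <= s] are listed in [l]. *)
Definition is_basic : set (set (germ Y)) :=
  [set B | exists s l, (forall t, t \in l -> nle t s) /\ B = germ_basic s l].

Lemma basicP s l p : germ_basic s l (mkgerm p) <->
  [/\ pg_char p (dd s),
      exists2 e : idem S, pg_char p e & pg_elt p * val e = s * val e &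
      forall t, t \in l -> ~~ pg_char p (dd t)].
Proof.
split=> [[q [/mkgermP[e1 [e he ee]] <- h]]|[hs [e he ee] h]].
  split; [by rewrite e1; exact: pg_dom|by exists e|by rewrite e1].
exists (PreGerm (pg_in p) hs); split=> //.
by apply/mkgermP; split=> //; exists e.
Qed.

Lemma nle_dd (t s : S) (e : idem S) : nle t s -> nle (t * val e) (s * val e).
Proof.
move=> [f hf ->]; exists f => //.
by rewrite -!mulgA (idemC hf (idem_valP e)).
Qed.

Lemma basic_cover : \bigcup_(B in is_basic) B = [set: germ Y].
Proof.
apply/seteqP; split=> // g _; elim/germW: g => p.
exists (germ_basic (pg_elt p) [::]); first by exists (pg_elt p), [::].
by apply/basicP; split=> //; [exact: pg_dom|exists (dd (pg_elt p)) => //; exact: pg_dom].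
Qed.

Lemma basic_join (B C : set (germ Y)) g :
  is_basic B -> is_basic C -> B g -> C g ->
  exists D, [/\ is_basic D, D g & D `<=` B `&` C].
Proof.
move=> [s [l [hl ->]]] [t [m [hm ->]]].
elim/germW: g => p /basicP[hs [e he ee] hel] /basicP[ht [f hf ef] hem].
have [u [hu eu]] : exists u : idem S, pg_char p u /\ s * val u = t * val u.
  exists (imeet e f); rewrite charI he hf; split=> //=.
  rewrite mulgA -ee -[LHS]mulgA (idemC (idem_valP e) (idem_valP f)) mulgA ef.
  by rewrite -mulgA.
have nu (c : character S) a : c u -> c (dd (a * val u)) = c (dd a).
  by move=> cu; rewrite ddI charI cu andbT.
have lmP (c : character S) (k : seq S) : c u ->
    (forall a, a \in k -> ~~ c (dd a)) <->
    (forall a, a \in [seq b * val u | b <- k] -> ~~ c (dd a)).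
  move=> cu; split=> [h _ /mapP[a ak ->]|h a ak]; first by rewrite nu// h.
  by rewrite -(nu _ _ cu); apply: h; apply/mapP; exists a.
exists (germ_basic (s * val u) [seq b * val u | b <- l ++ m]); split.
- exists (s * val u), [seq b * val u | b <- l ++ m]; split=> // _ /mapP[b + ->].
  by rewrite mem_cat => /orP[/hl|/hm] h; [|rewrite eu]; exact: nle_dd.
- apply/basicP; split; first by rewrite nu.
    exists (imeet e u); first by rewrite charI he.
    rewrite [val _]/= mulgA ee -!mulgA; congr (_ * _).
    rewrite (idemC (idem_valP u) (idemM (idem_valP e) (idem_valP u))) -mulgA.
    by rewrite idem_valP.
  by apply/(lmP _ (l ++ m) hu).1 => a; rewrite mem_cat => /orP[/hel|/hem].
- move=> g; elim/germW: g => q /basicP[h1 [v hv ev]].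
  have qu : pg_char q u by move: h1; rewrite ddI charI => /andP[].
  move=> /(lmP _ (l ++ m) qu).2 h2.
  have ev' : pg_elt q * val (imeet u v) = s * val (imeet u v).
    rewrite /= (idemC (idem_valP u) (idem_valP v)) mulgA ev -!mulgA; congr (_ * _).
    rewrite (idemC (idem_valP v) (idem_valP u)) mulgA idem_valP.
    by [].
  have huv : pg_char q (imeet u v) by rewrite charI qu.
  split; apply/basicP; split.
  + by move: h1; rewrite nu.
  + by exists (imeet u v).
  + by move=> a al; apply: h2; rewrite mem_cat al.
  + by move: h1; rewrite eu nu.
  + by exists (imeet u v) => //; rewrite ev' /= !mulgA eu.
  + by move=> a al; apply: h2; rewrite mem_cat al orbT.
Qed.

End GermBasis.

HB.instance Definition _ (S : invSemigroupType) (Y : set (character S)) :=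
  @isBaseTopological.Build (germ Y) (set (germ Y)) is_basic id
    (@basic_cover S Y) (@basic_join S Y).

Section Topology.
Context {S : invSemigroupType}.
Implicit Type phi : character S.

Lemma char_cvg (F : set_system (character S)) phi : Filter F ->
  (forall e, F [set psi | psi e = phi e]) -> F --> phi.
Proof.
move=> FF h A; rewrite nbhsE => -[_ [[B oB <-] Bphi] sA].
apply: filterS sA _.
suff : (@char_fun S @ F) --> (char_fun phi : {ptws idem S -> bool}).
  by apply; exact: open_nbhs_nbhs.
apply/cvg_sup => e C; rewrite nbhsE => -[_ [[D oD <-] Dphi] sC].
by apply: filterS sC _; apply: filterS (h e) => psi /= ->.
Qed.

Lemma char_nbhs phi e : nbhs phi [set psi : character S | psi e = phi e].
Proof.
rewrite nbhsE; exists [set psi : character S | psi e = phi e] => //; split=> //.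
have c : continuous (fun psi : character S => (psi e : bool)).
  move=> psi; apply: (@continuous_comp _ _ _ (@char_fun S : character S -> {ptws idem S -> bool}) (fun f : {ptws idem S -> bool} => f e)).
    exact: initial_continuous.
  exact: (@proj_continuous _ (fun _ : idem S => bool) e).
have := open_comp (f := fun psi : character S => (psi e : bool)) (D := [set phi e]).
by apply=> [psi _|]; [exact: c|exact: discrete_open].
Qed.

Lemma char_nbhs_seq phi (l : seq (idem S)) :
  nbhs phi [set psi : character S | forall e, e \in l -> psi e = phi e].
Proof.
elim: l => [|e l IH]; first by apply: filterS filterT.
apply: filterS (filterI (char_nbhs phi e) IH) => psi [/= h1 h2] f.
by rewrite inE => /orP[/eqP->//|/h2].
Qed.

Lemma germ_openP (Y : set (character S)) (U : set (germ Y)) :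
  open U <-> forall g, U g -> exists B, [/\ is_basic B, B g & B `<=` U].
Proof.
split=> [[D sD <-] g [B DB Bg]|h].
  by exists B; split=> //; [exact: sD|move=> x Bx; exists B].
exists [set B | is_basic B /\ B `<=` U]; first by move=> B [].
apply/seteqP; split=> [g [B [_ BU] /BU]//|g /h[B [? ? ?]]].
by exists B.
Qed.

Lemma basic_open (Y : set (character S)) (B : set (germ Y)) :
  is_basic B -> open B.
Proof. by move=> hB; apply/germ_openP => g Bg; exists B; split. Qed.

Lemma basic_compact (Y : set (character S)) (s : S) (l : seq S) :
  closed Y -> compact (germ_basic s l : set (germ Y)).
Proof.
move=> clY; rewrite compact_ultra => F FU FB.
pose G : set_system (character S) := gdom @ F.
have GF : ProperFilter G by apply: fmap_proper_filter.
have GU (e : idem S) : G [set psi : character S | psi e] \/ G [set psi : character S | ~~ psi e].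
  case: (in_ultra_setVsetC (gdom @^-1` [set psi : character S | psi e]) FU) => h; [by left|right].
  by apply: (filterS _ h : F _) => g /= hg; apply/negP.
pose f (e : idem S) := `[< G [set psi : character S | psi e] >].
have hf (e : idem S) : G [set psi : character S | psi e = f e].
  rewrite /f; case: asboolP => [h|h]; first by apply: filterS h => psi.
  by case: (GU e) => // h'; apply: filterS h' => psi /negbTE.
have GK : G [set psi : character S | [/\ Y psi, psi (dd s) & forall t, t \in l -> ~~ psi (dd t)]].
  apply: (filterS _ FB : F _) => g /= gB.
  move: g gB; apply: (@germW S Y) => p /basicP[h1 h2 h3].
  by rewrite gdomE; split=> //; exact: pg_in.
have [fs] : exists e, f e.
  exists (dd s); have [psi [h [_ h' _]]] := filter_ex (filterI (hf (dd s)) GK).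
  by rewrite -h.
move=> fneq0.
have f0 : f izero = false.
  by have [psi /= <-] := filter_ex (hf izero); rewrite char0.
have fI e1 e2 : f (imeet e1 e2) = f e1 && f e2.
  have [psi [[/= <- <-] <-]] :=
    filter_ex (filterI (filterI (hf (imeet e1 e2)) (hf e1)) (hf e2)).
  by rewrite charI.
pose phi := Character (ex_intro _ fs fneq0) f0 fI.
have Gphi : G --> phi by exact: char_cvg.
have Yphi : Y phi.
  apply: clY => A /Gphi GA; have [psi [[h _ _] h']] := filter_ex (filterI GK GA).
  by exists psi.
have phis : phi (dd s).
  by have [psi [/= <- [_ ? _]]] := filter_ex (filterI (hf (dd s)) GK).
have phil t : t \in l -> ~~ phi (dd t).
  by move=> tl; have [psi [/= <- [_ _ h]]] := filter_ex (filterI (hf (dd t)) GK); exact: h.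
pose p := PreGerm Yphi phis.
exists (mkgerm p); split; first by exists p.
move=> A; rewrite nbhsE => -[U [oU Up] sU]; apply: filterS sU _.
have /germ_openP/(_ _ Up)[_ [[t [m [hm ->]]] hB sB]] := oU.
apply: filterS sB _; move: hB => /basicP[h1 [e he ee] h2].
have G1 : G [set psi : character S | forall u, u \in e :: dd t :: map dd m -> psi u = phi u].
  exact/Gphi/char_nbhs_seq.
apply: (filterS _ (filterI FB (G1 : F (gdom @^-1` _)))) => g /=; move: g.
apply: (@germW S Y) => q [/basicP[k1 [v hv ev] k2]]; rewrite gdomE => k3.
have qe : pg_char q e by have -> : pg_char q e = f e by apply: k3; rewrite !inE eqxx.
apply/basicP; split.
- by have -> : pg_char q (dd t) = f (dd t) by apply: k3; rewrite !inE eqxx orbT.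
- exists (imeet v e); first by rewrite charI hv.
  by rewrite /= mulgA ev -mulgA (idemC (idem_valP v) (idem_valP e)) mulgA ee -mulgA.
- move=> u um; have -> : pg_char q (dd u) = f (dd u).
    by apply: k3; rewrite !inE map_f ?orbT.
  exact: h2.
Qed.

Lemma compact_open_basic (Y : set (character S)) (U : set (germ Y)) :
  compact U -> open U ->
  exists l : seq (set (germ Y)), (forall B, B \in l -> is_basic B) /\
    U = [set g | exists2 B, B \in l & B g].
Proof.
move=> /compact_near_coveringP cU /germ_openP oU.
pose good B := is_basic B /\ B `<=` U.
pose F : set_system (seq (set (germ Y))) :=
  filter_from setT
    (fun l0 : seq (set (germ Y)) => [set l | {subset l0 <= l}]).
have FF : Filter F.
  apply: filter_from_filter; first by exists [::].
  move=> l1 l2 _ _; exists (l1 ++ l2) => // l h; split=> B Bl; apply: h;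
  by rewrite mem_cat Bl ?orbT.
have [|l _ hl] := cU _ F (fun l g => exists B, [/\ B \in l, good B & B g]) FF.
  move=> g /oU[B [bB Bg BU]].
  exists (B, [set l | B \in l]).
    split; first exact: (open_nbhs_nbhs (conj (basic_open bB) Bg)).
    by exists [:: B] => // l /= h; apply: h; rewrite inE.
  by move=> [g' l] /= [Bg' Bl]; exists B.
exists [seq B <- l | `[< good B >]]; split.
  by move=> B; rewrite mem_filter => /andP[/asboolP[]].
apply/seteqP; split=> [g Ug|g [B]].
  have [B [Bl gB Bg]] := hl l (fun _ => id) g Ug.
  by exists B => //; rewrite mem_filter Bl andbT; apply/asboolP.
by rewrite mem_filter => /andP[/asboolP[_ BU] _ /BU].
Qed.

Lemma basic_compact_open (Y : set (character S)) (l : seq (set (germ Y))) :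
  closed Y -> (forall B, B \in l -> is_basic B) ->
  compact [set g | exists2 B, B \in l & B g] /\
  open [set g | exists2 B, B \in l & B g].
Proof.
move=> clY hl; split; last first.
  by apply/germ_openP => g [B Bl Bg]; exists B; split=> //; [exact: hl|move=> x; exists B].
elim: l hl => [|B l IH] hl.
  rewrite (_ : [set _ | _] = set0); first exact: compact0.
  by rewrite -subset0 => g [].
have -> : [set g | exists2 B', B' \in B :: l & B' g] = B `|` [set g | exists2 B, B \in l & B g].
  apply/seteqP; split=> g.
    by move=> [C]; rewrite inE => /orP[/eqP->|Cl Cg]; [left|right; exists C].
  by move=> [Bg|[C Cl Cg]]; [exists B; rewrite ?inE ?eqxx|exists C; rewrite ?inE ?Cl ?orbT].
apply: compactU.
  by have [s [m [_ ->]]] := hl B (mem_head _ _); exact: basic_compact.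
by apply: IH => C Cl; apply: hl; rewrite inE Cl orbT.
Qed.

End Topology.

Section Spectrum.
Context {S : invSemigroupType}.
Implicit Type X : set (idem S * {fset idem S}).

Lemma inv_closure_invariant X : S_invariant (inv_closure X).
Proof.
move=> e F h s M [/= hM XM]; exact: (hM _ _ (h M (conj hM XM))).
Qed.

Lemma big_orb_has (P : idem S -> bool) (F : {fset idem S}) :
  \big[orb/false]_(f <- F) P f = has P F.
Proof. by rewrite big_has. Qed.

Lemma spectrum_closed X : closed (spectrum X).
Proof.
move=> phi cphi e F XeF.
have [psi [hpsi hl]] := cphi _ (char_nbhs_seq phi (e :: F)).
rewrite -hl ?inE ?eqxx// (hpsi _ _ XeF) !big_orb_has.
by apply: eq_in_has => f fF; rewrite hl// inE fF orbT.
Qed.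

Lemma spectrum_invariant X : S_invariant X -> invariant (spectrum X).
Proof.
move=> hX s phi h hphi e F XeF /=.
rewrite (hphi _ _ (hX _ _ XeF s)) !big_orb_has.
apply/hasP/hasP => [[x /imfsetP[f /= fF ->] hf]|[f fF hf]]; first by exists f.
by exists (iconj s f) => //; apply/imfsetP; exists f.
Qed.

End Spectrum.

Section Bisections.
Context {S : invSemigroupType} {Y : set (character S)}.
Hypotheses (clY : closed Y) (invY : invariant Y).
Implicit Types (p q r : pregerm Y) (g h k : germ Y) (U V W : set (germ Y)).

Definition compact_open_bisection U : Prop :=
  [/\ compact U, open U & bisection U].

Lemma inv_ex g : exists h, germ_inv g h.
Proof.
elim/germW: g => p.
have hd : pg_act p (dd (pg_elt p)^-1) by rewrite /= iconjd pg_dom.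
exists (mkgerm (PreGerm (invY (pg_dom p) (pg_in p)) hd)).
by exists p, (PreGerm (invY (pg_dom p) (pg_in p)) hd).
Qed.

Lemma dom_inj_unit g h : germ_comp g g g -> germ_comp h h h ->
  gdom g = gdom h -> g = h.
Proof.
move=> cg ch e; have [dh _ _] := comp_dom ch.
have [k c] := @comp_ex S Y g h (etrans e dh).
have kh : k = h.
  have [z c1 c2] := compA cg c; have zk := comp_fun c c1; subst z.
  have [g' ig] := inv_ex g.
  exact: (comp_fun (comp_Kl c2 ig) (comp_Kl c ig)).
have kg : k = g.
  have [z c1 c2] := compA' ch c; have zk := comp_fun c c1; subst z.
  have [h' ih] := inv_ex h.
  exact: (comp_fun (comp_Kr c2 ih) (comp_Kr c ih)).
by rewrite -kg kh.
Qed.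

Lemma inv_fun g h h' : germ_inv g h -> germ_inv g h' -> h = h'.
Proof.
move=> i1 i2; have [z c] := @comp_ex S Y h g (inv_dom i1).
have j1 := comp_Kr c i1.
have [z' c'] := @comp_ex S Y h' g (inv_dom i2).
have zz : z = z'.
  apply: dom_inj_unit; last first.
  - by have [_ -> _] := comp_dom c; have [_ -> _] := comp_dom c'.
  - have c2 := comp_Kr c' i2; have [x c3] := @comp_ex S Y z' z' (let: And3 d1 d2 d3 := comp_dom c' in etrans d2 (etrans (esym (inv_cod i2)) (esym d3))).
    have [y c4 c5] := compA' c' c3; have [w c6 c7] := compA c2 c'.
    by have e1 := comp_fun c' c6; subst w; have := comp_fun c3 c7 => ex; subst x.
  - have c2 := comp_Kr c i1; have [x c3] := @comp_ex S Y z z (let: And3 d1 d2 d3 := comp_dom c in etrans d2 (etrans (esym (inv_cod i1)) (esym d3))).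
    have [w c6 c7] := compA c2 c.
    by have e1 := comp_fun c c6; subst w; have := comp_fun c3 c7 => ex; subst x.
subst z'.
exact: (comp_fun (comp_Kr c i1) (comp_Kr c' i1)).
Qed.

Lemma basic_mul B C : is_basic B -> is_basic C ->
  is_basic (germ_mul B C : set (germ Y)).
Proof.
move=> [s [l [hl ->]]] [t [m [hm ->]]].
exists (s * t), ([seq a * t | a <- l] ++ [seq s * b | b <- m]); split.
  move=> u; rewrite mem_cat => /orP[/mapP[a /hl[f hf ->] ->]|/mapP[b /hm[f hf ->] ->]].
    exists (val (iconj t (Idem hf))); first exact: idem_valP.
    by rewrite -!mulgA -mulsC_idem.
  by exists f => //; rewrite mulgA.
apply/seteqP; split=> [k [g [h [[p [-> ps pl]] [q [-> qt qm]] /comp_mkP[e ->]]]]|k [r [-> rst hr]]].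
  exists (pg_mul e); split=> //=; first by rewrite ps qt.
  have cp f : pg_char p f = pg_char q (iconj t f) by rewrite e /= qt.
  move=> u; rewrite mem_cat => /orP[/mapP[a al ->]|/mapP[b bm ->]].
    by rewrite ddM -cp pl.
  have [f hf eb] := hm b bm; subst b.
  rewrite mulgA -[f]/(val (Idem hf)) ddI charI negb_and.
  have := qm _ bm; rewrite -[f]/(val (Idem hf)) ddI charI negb_and.
  by rewrite -qt pg_dom /= => ->; rewrite orbT.
have rd : pg_char r (dd t).
  have := pg_dom r; rewrite rst ddM.
  have -> : iconj t (dd s) = imeet (iconj t (dd s)) (dd t).
    by apply: val_inj; rewrite /= -!mulgA [t * (t^-1 * t)]mulgA mulsVs.
  by rewrite charI => /andP[].
have hs : act rd (dd s) by rewrite /= -ddM -rst pg_dom.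
pose q := PreGerm (pg_in r) rd.
pose p := PreGerm (invY rd (pg_in r)) hs.
exists (mkgerm p), (mkgerm q); split; last first.
- by exists p, q, r; split=> //; split=> //; apply: char_ext.
- exists q; split=> // b bm /=.
  have := hr (s * b); rewrite mem_cat (map_f (fun b => s * b) bm) orbT => /(_ isT).
  have [f hf eb] := hm b bm; subst b.
  rewrite mulgA -[f]/(val (Idem hf)) !ddI !charI !negb_and -rst pg_dom /= => ->.
  by rewrite orbT.
- exists p; split=> // a al /=.
  by have := hr (a * t); rewrite mem_cat (map_f (fun a => a * t) al) => /(_ isT); rewrite ddM.
Qed.

Lemma germ_setinvK U : germ_setinv (germ_setinv U) = U.
Proof.
apply/seteqP; split=> [g [h [g' Ug' i1] i2]|g Ug].
  by rewrite (inv_fun i2 (inv_sym i1)).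
have [h ih] := inv_ex g; exists h; last exact: inv_sym.
by exists g.
Qed.

Lemma basic_inv_sub s l : (forall t, t \in l -> nle t s) ->
  germ_setinv (germ_basic s l) `<=`
    (germ_basic s^-1 [seq t^-1 | t <- l] : set (germ Y)).
Proof.
move=> hl h [g [p [-> ps pl]] [p' [q [/mkgermP pp' -> e1 e2]]]].
have [g0 ig0] := inv_ex (mkgerm p).
have hd : pg_act p (dd (pg_elt p)^-1) by rewrite /= iconjd pg_dom.
pose q' := PreGerm (invY (pg_dom p) (pg_in p)) hd.
have -> : mkgerm q = mkgerm q'.
  apply: (@inv_fun (mkgerm p)); last by exists p, q'.
  by exists p', q; split=> //; apply/mkgermP.
exists q'; split=> //=; first by rewrite ps.
move=> _ /mapP[t tl ->]; have [f hf et] := hl t tl; rewrite /= ps.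
suff -> : iconj s (dd t^-1) = dd t by exact: pl.
apply: val_inj; rewrite /= sinvK et sinvM (sinv_idem hf).
have -> : s^-1 * (s * f * (f * s^-1)) * s = (s^-1 * s) * (f * f) * (s^-1 * s).
  by rewrite !mulgA.
rewrite hf -mulgA (idemC hf (idemVM s)) mulgA idemVM (idemC (idemVM s) hf).
have -> : f * s^-1 * (s * f) = f * ((s^-1 * s) * f) by rewrite !mulgA.
by rewrite (idemC (idemVM s) hf) [RHS]mulgA hf.
Qed.

Lemma basic_inv B : is_basic B -> is_basic (germ_setinv B : set (germ Y)).
Proof.
move=> [s [l [hl ->]]]; exists s^-1, [seq t^-1 | t <- l].
have hl' t : t \in [seq t^-1 | t <- l] -> nle t s^-1.
  move=> /mapP[{}t tl ->]; have [f hf ->] := hl t tl.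
  rewrite sinvM (sinv_idem hf).
  exists (val (iconj s^-1 (Idem hf))); first exact: idem_valP.
  by rewrite -mulsC_idem.
split=> //; apply/seteqP; split; first exact: basic_inv_sub.
move=> g hg.
have [h ih] := inv_ex g; exists h; last exact: inv_sym.
have : germ_setinv (germ_basic s^-1 [seq t^-1 | t <- l]) h by exists g.
move=> /(basic_inv_sub hl'); rewrite sinvK -map_comp.
by rewrite (eq_map (g := id)) ?map_id// => t /=; rewrite sinvK.
Qed.

Lemma mul_compact_open U V : compact U -> open U -> compact V -> open V ->
  compact (germ_mul U V) /\ open (germ_mul U V).
Proof.
move=> cU oU cV oV.
have [l [hl ->]] := compact_open_basic cU oU.
have [m [hm ->]] := compact_open_basic cV oV.
have -> : germ_mul [set g | exists2 B, B \in l & B g] [set g | exists2 B, B \in m & B g]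
  = [set g | exists2 B, B \in [seq germ_mul B C | B <- l, C <- m] & B g].
  apply/seteqP; split=> [k [g [h [[B Bl Bg] [C Cm Ch] c]]]|k [_ /allpairsP[[B C] /= [Bl Cm ->]] [g [h [Bg Ch c]]]]].
    exists (germ_mul B C); last by exists g, h.
    by apply/allpairsP; exists (B, C).
  by exists g, h; split=> //; [exists B|exists C].
apply: basic_compact_open => // _ /allpairsP[[B C] /= [Bl Cm ->]].
by apply: basic_mul; [exact: hl|exact: hm].
Qed.

Lemma inv_compact_open U : compact U -> open U ->
  compact (germ_setinv U) /\ open (germ_setinv U).
Proof.
move=> cU oU; have [l [hl ->]] := compact_open_basic cU oU.
have -> : germ_setinv [set g | exists2 B, B \in l & B g]
  = [set g | exists2 B, B \in [seq germ_setinv B | B <- l] & B g].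
  apply/seteqP; split=> [k [g [B Bl Bg] i]|k [_ /mapP[B Bl ->] [g Bg i]]].
    by exists (germ_setinv B); [exact: map_f|exists g].
  by exists g => //; exists B.
apply: basic_compact_open => // _ /mapP[B Bl ->].
by apply: basic_inv; exact: hl.
Qed.

Lemma mul_cob U V : compact_open_bisection U -> compact_open_bisection V ->
  compact_open_bisection (germ_mul U V).
Proof.
move=> [cU oU [dU rU]] [cV oV [dV rV]].
have [c o] := mul_compact_open cU oU cV oV; split=> //; split.
  move=> k k' /set_mem[g [h [Ug Vh gh]]] /set_mem[g' [h' [Ug' Vh' gh']]].
  have [d1 -> _] := comp_dom gh; have [d1' -> _] := comp_dom gh' => e.
  have hh := dV _ _ (mem_set Vh) (mem_set Vh') e; subst h'.
  have gg := dU _ _ (mem_set Ug) (mem_set Ug') (etrans d1 (esym d1')).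
  by subst g'; exact: comp_fun gh gh'.
move=> k k' /set_mem[g [h [Ug Vh gh]]] /set_mem[g' [h' [Ug' Vh' gh']]].
have [d1 _ ->] := comp_dom gh; have [d1' _ ->] := comp_dom gh' => e.
have gg := rU _ _ (mem_set Ug) (mem_set Ug') e; subst g'.
have hh := rV _ _ (mem_set Vh) (mem_set Vh') (etrans (esym d1) d1').
by subst h'; exact: comp_fun gh gh'.
Qed.

Lemma inv_cob U : compact_open_bisection U ->
  compact_open_bisection (germ_setinv U).
Proof.
move=> [cU oU [dU rU]]; have [c o] := inv_compact_open cU oU.
split=> //; split=> h h' /set_mem[g Ug i] /set_mem[g' Ug' i'].
  rewrite (inv_dom i) (inv_dom i') => e.
  have gg := rU _ _ (mem_set Ug) (mem_set Ug') e.
  by subst g'; exact: inv_fun i i'.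
rewrite (inv_cod i) (inv_cod i') => e.
have gg := dU _ _ (mem_set Ug) (mem_set Ug') e.
by subst g'; exact: inv_fun i i'.
Qed.

Lemma set0_cob : compact_open_bisection (set0 : set (germ Y)).
Proof.
split; [exact: compact0|exact: open0|].
by split=> x y /set_mem.
Qed.

Lemma germ_mulA U V W : germ_mul U (germ_mul V W) = germ_mul (germ_mul U V) W.
Proof.
apply/seteqP; split=> [y [g [z [Ug [h [k [Vh Wk c1]]] c2]]]|y [x [k [[g [h [Ug Vh c1]]] Wk c2]]]].
  have [x c3 c4] := compA' c1 c2; exists x, k; split=> //.
  by exists g, h.
have [z c3 c4] := compA c1 c2; exists g, z; split=> //.
by exists h, k.
Qed.

Lemma germ_mulVK U : bisection U ->
  germ_mul (germ_mul U (germ_setinv U)) U = U.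
Proof.
move=> [dU rU]; apply/seteqP; split=> [y [x [k [[g [h' [Ug [h Uh i] c1]]] Uk c2]]]|g Ug].
  have [d1 d2 _] := comp_dom c1; have [d3 _ _] := comp_dom c2.
  have gh : g = h by apply: dU; rewrite ?inE// d1 (inv_cod i).
  have hk : h = k by apply: rU; rewrite ?inE// -d3 d2 (inv_dom i).
  subst h k; have c3 := comp_Kr c1 (inv_sym i).
  by rewrite (comp_fun c2 c3).
have [h i] := inv_ex g.
have [x c] := @comp_ex S Y g h (esym (inv_cod i)).
exists x, g; split=> //; last exact: comp_Kr c (inv_sym i).
by exists g, h; split=> //; exists g.
Qed.

Lemma setinv_bisection U : bisection U -> bisection (germ_setinv U).
Proof.
move=> [dU rU]; split=> h h' /set_mem[g Ug i] /set_mem[g' Ug' i'].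
  rewrite (inv_dom i) (inv_dom i') => e.
  have gg := rU _ _ (mem_set Ug) (mem_set Ug') e.
  by subst g'; exact: inv_fun i i'.
rewrite (inv_cod i) (inv_cod i') => e.
have gg := dU _ _ (mem_set Ug) (mem_set Ug') e.
by subst g'; exact: inv_fun i i'.
Qed.

Lemma germ_mulVVK U : bisection U ->
  germ_mul (germ_mul (germ_setinv U) U) (germ_setinv U) = germ_setinv U.
Proof.
by move=> /setinv_bisection/germ_mulVK; rewrite germ_setinvK.
Qed.

Lemma idem_unit U g : bisection U -> germ_mul U U = U -> U g ->
  germ_comp g g g.
Proof.
move=> [dU rU] UU Ug; have : germ_mul U U g by rewrite UU.
move=> [h [k [Uh Uk c]]]; have [d1 d2 d3] := comp_dom c.
have gk : g = k by apply: dU; rewrite ?inE.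
have gh : g = h by apply: rU; rewrite ?inE.
by subst h k.
Qed.

Lemma unit_comp g h k : germ_comp g g g -> germ_comp h h h ->
  germ_comp g h k -> g = h /\ k = h.
Proof.
move=> cg ch c; have [d1 _ _] := comp_dom c; have [d2 _ _] := comp_dom ch.
have gh : g = h by apply: dom_inj_unit => //; rewrite d1 d2.
by subst h; split=> //; exact: comp_fun c ch.
Qed.

Lemma mul_units U V : (forall g, U g -> germ_comp g g g) ->
  (forall g, V g -> germ_comp g g g) -> germ_mul U V = U `&` V.
Proof.
move=> hU hV; apply/seteqP; split=> [k [g [h [Ug Vh c]]]|g [Ug Vg]].
  by have [gh ->] := unit_comp (hU _ Ug) (hV _ Vh) c; subst h.
by exists g, g; split=> //; exact: hU.
Qed.

Lemma units_idem U : (forall g, U g -> germ_comp g g g) -> germ_mul U U = U.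
Proof. by move=> hU; rewrite mul_units// setIid. Qed.

Lemma units_bisection U : (forall g, U g -> germ_comp g g g) -> bisection U.
Proof.
move=> hU; split=> g h /set_mem Ug /set_mem Uh e.
  by apply: dom_inj_unit => //; exact: hU.
apply: dom_inj_unit; [exact: hU|exact: hU|].
by have [-> _ _] := comp_dom (hU _ Ug); have [-> _ _] := comp_dom (hU _ Uh).
Qed.

End Bisections.

Lemma sinv_unique_of_comm (T : semigroupType) (v : T -> T) :
  (forall x, x * v x * x = x) -> (forall x, v x * x * v x = v x) ->
  (forall e f : T, e * e = e -> f * f = f -> e * f = f * e) ->
  forall x y : T, x * y * x = x -> y * x * y = y -> y = v x.
Proof.
move=> vK Kv cI x y xyx yxy; set z := v x.
have iyx : y * x * (y * x) = y * x by rewrite mulgA yxy.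
have ixy : x * y * (x * y) = x * y by rewrite mulgA xyx.
have izx : z * x * (z * x) = z * x by rewrite mulgA Kv.
have ixz : x * z * (x * z) = x * z by rewrite mulgA vK.
have e1 : y = z * x * y.
  rewrite -[LHS]yxy -{1}[x]vK -/z.
  have -> : y * (x * z * x) * y = (y * x) * (z * x) * y by rewrite !mulgA.
  by rewrite (cI _ _ iyx izx) -!mulgA [y * (x * y)]mulgA yxy.
have e2 : z = z * x * y.
  rewrite -[LHS]Kv -/z -{1}xyx.
  have -> : z * (x * y * x) * z = z * ((x * y) * (x * z)) by rewrite !mulgA.
  by rewrite (cI _ _ ixy ixz) !mulgA Kv.
by rewrite e1 -e2.
Qed.

(* B_X(S); the space of units is restricted to the characters satisfying X'.
   With X empty all characters remain, and this is B(S). *)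
Definition BX (S : invSemigroupType) (X : set (idem S * {fset idem S})) :=
  {U : set (germ (spectrum (inv_closure X))) | `[< compact_open_bisection U >]}.

HB.instance Definition _ S X := Choice.on (@BX S X).

Section BXTheory.
Context {S : invSemigroupType} (X : set (idem S * {fset idem S})).
Local Notation Y := (spectrum (inv_closure X)).
Local Notation B := (BX X).
Implicit Types a b c : B.

Let clY : closed Y. Proof. exact: spectrum_closed. Qed.
Let invY : invariant Y.
Proof. by apply: spectrum_invariant; exact: inv_closure_invariant. Qed.

Lemma BXP a : compact_open_bisection (val a).
Proof. by case: a => U /= /asboolP. Qed.

Definition mkBX (U : set (germ Y)) (hU : compact_open_bisection U) : B :=
  exist _ U (introT (asboolP _) hU).

Definition BX_mul a b : B := mkBX (mul_cob clY invY (BXP a) (BXP b)).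
Definition BX_inv a : B := mkBX (inv_cob clY invY (BXP a)).
Definition BX_zero : B := mkBX (@set0_cob S Y).

Lemma BX_mulA : associative BX_mul.
Proof. by move=> a b c; apply: val_inj; exact: germ_mulA. Qed.

HB.instance Definition _ := isSemigroup.Build B BX_mulA.

Lemma val_BXM a b : val (a * b) = germ_mul (val a) (val b).
Proof. by []. Qed.

Lemma BX_bis a : bisection (val a). Proof. by case: (BXP a). Qed.

Lemma BX_vK a : a * BX_inv a * a = a.
Proof. by apply: val_inj; exact: (germ_mulVK invY (BX_bis a)). Qed.

Lemma BX_Kv a : BX_inv a * a * BX_inv a = BX_inv a.
Proof. by apply: val_inj; exact: (germ_mulVVK invY (BX_bis a)). Qed.

Lemma BX_idem_unit a : a * a = a -> forall g, val a g -> germ_comp g g g.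
Proof.
move=> aa g; apply: (idem_unit (BX_bis a)).
by rewrite -val_BXM aa.
Qed.

Lemma BX_cI a b : a * a = a -> b * b = b -> a * b = b * a.
Proof.
move=> /BX_idem_unit ha /BX_idem_unit hb; apply: val_inj; rewrite !val_BXM.
by rewrite !(mul_units invY)// setIC.
Qed.

Lemma BX_0m a : BX_mul BX_zero a = BX_zero.
Proof. by apply: val_inj; rewrite /= -subset0 => k [g [h []]]. Qed.

Lemma BX_m0 a : BX_mul a BX_zero = BX_zero.
Proof. by apply: val_inj; rewrite /= -subset0 => k [g [h []]]. Qed.

HB.instance Definition _ := Semigroup_isInverse.Build B BX_vK BX_Kv
  (sinv_unique_of_comm BX_vK BX_Kv BX_cI) BX_0m BX_m0.

End BXTheory.

Section Congruence.
Context {S : invSemigroupType}.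
Local Notation BS := (BX (@set0 (idem S * {fset idem S}))).
Implicit Types (a b c e f : BS) (X : set (character S)).

(* The ideal I_X. A compact-open set of characters is identified with the
   idempotent of B(S) consisting of the unit germs over it; [gdom @` val f] is
   the set of characters identified with [f]. *)
Definition ideal X : set BS :=
  [set f : BS | idempotent f /\ gdom @` (val f) `&` X = set0].

Definition sim X a b : Prop := exists e f g : BS,
  [/\ idempotent e, idem_join [set e; f] (a^-1 * a) &
      idem_join [set e; g] (b^-1 * b)] /\
  [/\ ideal X f, ideal X g & a * e = b * e].

Let Y0 := spectrum (inv_closure (@set0 (idem S * {fset idem S}))).
Let clY0 : closed Y0. Proof. exact: spectrum_closed. Qed.
Let invY0 : invariant Y0.
Proof. by apply: spectrum_invariant; exact: inv_closure_invariant. Qed.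

Lemma val_idemM e f : idempotent e -> idempotent f ->
  val (e * f) = val e `&` val f.
Proof.
by move=> /BX_idem_unit he /BX_idem_unit hf; rewrite val_BXM (mul_units invY0).
Qed.

Lemma unit_idem a : (forall g, val a g -> germ_comp g g g) -> idempotent a.
Proof.
by move=> h; apply: val_inj; rewrite val_BXM (units_idem invY0).
Qed.

Lemma idem_nle_sub e f : idempotent e -> idempotent f ->
  nle e f <-> val e `<=` val f.
Proof.
move=> he hf; rewrite idem_nle//; split=> [->|/setIidPr sef].
  by rewrite val_idemM//; exact: subIsetl.
by apply: val_inj; rewrite val_idemM.
Qed.

Lemma union_cob e f : idempotent e -> idempotent f ->
  compact_open_bisection (val e `|` val f).
Proof.
move=> /BX_idem_unit he /BX_idem_unit hf.
have [[ce oe _] [cf of_ _]] := (BXP e, BXP f); split.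
- exact: compactU.
- exact: openU.
- by apply: (units_bisection invY0) => g [/he|/hf].
Qed.

Definition ijoin e f (he : idempotent e) (hf : idempotent f) : BS :=
  mkBX (union_cob he hf).

Lemma ijoin_idem e f he hf : idempotent (@ijoin e f he hf).
Proof.
by apply: unit_idem => g [/(BX_idem_unit he)|/(BX_idem_unit hf)].
Qed.

Lemma val_ijoin e f (he : idempotent e) (hf : idempotent f) :
  val (ijoin he hf) = val e `|` val f.
Proof. by []. Qed.

Lemma idem_joinP e f a : idempotent e -> idempotent f ->
  idem_join [set e; f] a <-> val a = val e `|` val f.
Proof.
move=> he hf; have hj := ijoin_idem he hf; split=> [[ha h1 h2]|ea].
  apply/seteqP; split.
    rewrite -[_ `|` _]/(val (ijoin he hf)); apply/idem_nle_sub => //.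
    apply: h2 => // x [->|->]; apply/idem_nle_sub => //;
    [exact: subsetUl|exact: subsetUr].
  by move=> g []; [have /idem_nle_sub := h1 e (or_introl erefl); apply|
                  have /idem_nle_sub := h1 f (or_intror erefl); apply].
have -> : a = ijoin he hf by apply: val_inj.
split=> // [x [->|->]|y hy h]; try apply/idem_nle_sub => //.
- exact: subsetUl.
- exact: subsetUr.
- move=> g []; [have /idem_nle_sub := h e (or_introl erefl); apply|
                have /idem_nle_sub := h f (or_intror erefl); apply] => //.
Qed.

Lemma ideal_sub X e f : idempotent e -> val e `<=` val f -> ideal X f ->
  ideal X e.
Proof.
move=> he sef [_ hf]; split=> //; rewrite -subset0 -hf => c [[g eg <-] Xc].
by split=> //; exists g => //; exact: sef.
Qed.

Lemma ideal_notin X f g : ideal X f -> val f g -> ~ X (gdom g).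
Proof.
by move=> [_ hf] fg Xg; have : set0 (gdom g) by rewrite -hf; split=> //; exists g.
Qed.

Lemma idealP X f : idempotent f -> (forall g, val f g -> ~ X (gdom g)) ->
  ideal X f.
Proof.
move=> hf h; split=> //; rewrite -subset0 => c [[g fg <-] Xc].
exact: (h g).
Qed.

Lemma idem_BX0 : idempotent (0 : BS). Proof. exact: idem0. Qed.

Lemma ideal0 X : ideal X 0.
Proof. by apply: idealP => [|g //]; exact: idem0. Qed.

Lemma sim_refl X a : sim X a a.
Proof.
exists (a^-1 * a), 0, 0; split; split; rewrite ?idem_joinP;
  try exact: idemVM; try exact: idem0; try exact: ideal0; try by [].
all: by rewrite setU0.
Qed.

Lemma sim_sym X a b : sim X a b -> sim X b a.
Proof.
by move=> [e [f [g [[h1 h2 h3] [h4 h5 h6]]]]]; exists e, g, f.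
Qed.

Lemma sim_trans X a b c : sim X a b -> sim X b c -> sim X a c.
Proof.
move=> [e [f [g [[he ja jb] [If Ig ab]]]]] [e' [f' [g' [[he' jb' jc] [If' Ig' bc]]]]].
have [hf hg hf' hg'] := And4 If.1 Ig.1 If'.1 Ig'.1.
move: ja jb jb' jc; rewrite !idem_joinP// => da db db' dc.
have hee := idemM he he'; have hef := idemM he hf'; have heg := idemM he' hg.
exists (e * e'), (ijoin hf hef), (ijoin hg' heg); split; split=> //.
- rewrite idem_joinP ?da ?val_idemM//; last exact: ijoin_idem.
  rewrite val_ijoin val_idemM//; apply/seteqP; split=> x.
    move=> [ex|fx]; last by right; left.
    have : val (b^-1 * b) x by rewrite db; left.
    by rewrite db' => -[?|?]; [left|right; right].
  by move=> [[ex _]|[fx|[ex _]]]; [left|right|left].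
- rewrite idem_joinP ?dc ?val_idemM//; last exact: ijoin_idem.
  rewrite val_ijoin val_idemM//; apply/seteqP; split=> x.
    move=> [ex|fx]; last by right; left.
    have : val (b^-1 * b) x by rewrite db'; left.
    by rewrite db => -[?|?]; [left|right; right].
  by move=> [[_ ex]|[fx|[ex _]]]; [left|right|left].
- apply: idealP; first exact: ijoin_idem.
  move=> x [/(ideal_notin If)//|]; rewrite val_idemM// => -[_ /(ideal_notin If')//].
- apply: idealP; first exact: ijoin_idem.
  move=> x [/(ideal_notin Ig')//|]; rewrite val_idemM// => -[_ /(ideal_notin Ig)//].
- by rewrite [LHS]mulgA ab -mulgA (idemC he he') [LHS]mulgA bc -mulgA.
Qed.

Lemma germ_mulUl (U V W : set (germ Y0)) :
  germ_mul (U `|` V) W = germ_mul U W `|` germ_mul V W.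
Proof.
apply/seteqP; split=> [k [g [h [[Ug|Vg] Wh c]]]|k [[g [h [Ug Wh c]]]|[g [h [Vg Wh c]]]]].
- by left; exists g, h.
- by right; exists g, h.
- by exists g, h; split=> //; left.
- by exists g, h; split=> //; right.
Qed.

Lemma germ_mulUr (U V W : set (germ Y0)) :
  germ_mul W (U `|` V) = germ_mul W U `|` germ_mul W V.
Proof.
apply/seteqP; split=> [k [g [h [Wg [Uh|Vh] c]]]|k [[g [h [Wg Uh c]]]|[g [h [Wg Vh c]]]]].
- by left; exists g, h.
- by right; exists g, h.
- by exists g, h; split=> //; left.
- by exists g, h; split=> //; right.
Qed.

Lemma sim_mulr X a b c : invariant X -> sim X a b -> sim X (a * c) (b * c).
Proof.
move=> invX [e [f [g [[he ja jb] [If Ig ab]]]]].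
have [hf hg] := (If.1, Ig.1).
move: ja jb; rewrite !idem_joinP// => da db.
have dM (x : BS) : (x * c)^-1 * (x * c) = c^-1 * (x^-1 * x) * c.
  by rewrite sinvM !mulgA.
have vM (x y z : BS) : val x = val y `|` val z ->
    val (c^-1 * x * c) = val (c^-1 * y * c) `|` val (c^-1 * z * c).
  by move=> e1; rewrite !val_BXM e1 germ_mulUr germ_mulUl.
have cI (u : BS) : ideal X u -> ideal X (c^-1 * u * c).
  move=> Iu; apply: idealP; first exact: (idemJ _ Iu.1).
  move=> k [x [h [[g1 [g2 [_ ug2 c1]]] _ c2]]] Xk.
  have [_ d2 _] := comp_dom c1; have [d3 d4 _] := comp_dom c2.
  apply: (ideal_notin Iu ug2); rewrite -d2 d3.
  move: Xk; rewrite d4; elim/germW: h {c2 d3 d4} => p.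
  by rewrite gdomE gcodE; exact: invX.
exists (c^-1 * e * c), (c^-1 * f * c), (c^-1 * g * c); split; split.
- exact: idemJ.
- by rewrite idem_joinP; [rewrite dM; exact: vM|exact: idemJ|exact: idemJ].
- by rewrite idem_joinP; [rewrite dM; exact: vM|exact: idemJ|exact: idemJ].
- exact: cI.
- exact: cI.
- have k : e * c = c * (c^-1 * e * c) := mulsC_idem c (Idem he).
  by rewrite -[a * c * _]mulgA -[b * c * _]mulgA -k !mulgA ab.
Qed.

Lemma sim_mull X a b c : sim X a b -> sim X (c * a) (c * b).
Proof.
move=> [e [f [g [[he ja jb] [If Ig ab]]]]].
have [hf hg] := (If.1, Ig.1).
move: ja jb; rewrite !idem_joinP// => da db.
have dle (x : BS) : (c * x)^-1 * (c * x) * (x^-1 * x) = (c * x)^-1 * (c * x).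
  by rewrite -!mulgA [x * (x^-1 * x)]mulgA mulsVs.
have de (x : BS) : idempotent e ->
    (x * e)^-1 * (x * e) = x^-1 * x * e.
  by move=> h; have := congr1 val (ddI x (Idem he)).
have ce : c * a * e = c * b * e by rewrite -!mulgA ab.
have dce : (c * a)^-1 * (c * a) * e = (c * b)^-1 * (c * b) * e.
  by rewrite -!de// ce.
have vI (x u v : BS) : idempotent u -> idempotent v -> val (x^-1 * x) = val u `|` val v ->
    val ((c * x)^-1 * (c * x)) =
    val ((c * x)^-1 * (c * x) * u) `|` val ((c * x)^-1 * (c * x) * v).
  move=> hu hv e1; rewrite -{1}dle val_BXM e1 germ_mulUr.
  by rewrite -!val_BXM.
have hm (x u : BS) : idempotent u -> idempotent ((c * x)^-1 * (c * x) * u).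
  by move=> hu; apply: idemM => //; exact: idemVM.
have sI (x u : BS) : ideal X u -> ideal X ((c * x)^-1 * (c * x) * u).
  move=> Iu; have hu := Iu.1; apply: ideal_sub (Iu); first exact: hm.
  by rewrite val_idemM; [exact: subIsetr|exact: idemVM|].
exists ((c * a)^-1 * (c * a) * e), ((c * a)^-1 * (c * a) * f),
       ((c * b)^-1 * (c * b) * g); split; split.
- exact: hm.
- by rewrite idem_joinP; [exact: vI|exact: hm|exact: hm].
- by rewrite idem_joinP; [rewrite dce; exact: vI|exact: hm|exact: hm].
- exact: sI.
- exact: sI.
- by rewrite {2}dce ![_ * (_ * _ * e)]mulgA ![_ * (_^-1 * _)]mulgA !mulsVs.
Qed.

Lemma sim_equiv_class X : equiv_class_of (fun a b => `[< sim X a b >]).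
Proof.
split=> [a|a b|b a c].
- by apply/asboolP; exact: sim_refl.
- by apply/asboolP/asboolP; exact: sim_sym.
- by move=> /asboolP ab /asboolP bc; apply/asboolP; exact: sim_trans ab bc.
Qed.

Canonical sim_equiv X := EquivRelPack (sim_equiv_class X).

End Congruence.

(* [quotB invX] is the quotient of B(S) by [sim X]; the invariance of [X] is
   what makes [sim X] a congruence. *)
Definition quotB (S : invSemigroupType) (X : set (character S))
  (invX : invariant X) := {eq_quot sim_equiv X}.

HB.instance Definition _ S X invX := Choice.on (@quotB S X invX).
HB.instance Definition _ S X invX := EqQuotient.on (@quotB S X invX).

Section Quotient.
Context {S : invSemigroupType} {X : set (character S)} (invX : invariant X).
Local Notation BS := (BX (@set0 (idem S * {fset idem S}))).
Local Notation Q := (quotB invX).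
Implicit Types (a b c : BS) (x y z : Q).

Definition piB a : Q := \pi_Q a.

Definition quot_mul x y : Q := piB (repr x * repr y).
Definition quot_inv x : Q := piB (repr x)^-1.
Definition quot_zero : Q := piB 0.

Lemma piBP a b : piB a = piB b <-> sim X a b.
Proof. by split => [/eqmodP/asboolP//|h]; apply/eqmodP/asboolP. Qed.

Lemma piBW (P : Q -> Prop) : (forall a, P (piB a)) -> forall x, P x.
Proof. by move=> h x; rewrite -[x]reprK; exact: h. Qed.

Lemma quot_mulE a b : quot_mul (piB a) (piB b) = piB (a * b).
Proof.
have /piBP ha : piB (repr (piB a)) = piB a := reprK _.
have /piBP hb : piB (repr (piB b)) = piB b := reprK _.
apply/piBP; apply: sim_trans (sim_mull _ hb) _.
exact: sim_mulr.
Qed.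

Lemma quot_mulA : associative quot_mul.
Proof.
elim/piBW=> a; elim/piBW=> b; elim/piBW=> c.
by rewrite !quot_mulE mulgA.
Qed.

HB.instance Definition _ := isSemigroup.Build Q quot_mulA.

Lemma piBM a b : piB (a * b) = piB a * piB b.
Proof. by rewrite -quot_mulE. Qed.

Lemma quot_vK x : x * quot_inv x * x = x.
Proof. by rewrite -{1 3 4}[x]reprK -/(piB _) /quot_inv -!piBM mulsVs. Qed.

Lemma quot_Kv x : quot_inv x * x * quot_inv x = quot_inv x.
Proof. by rewrite -{2}[x]reprK -/(piB _) /quot_inv -!piBM mulVsV. Qed.

Lemma quot_idem_lift x : x * x = x -> exists2 e, idempotent e & x = piB e.
Proof.
elim/piBW: x => a aa; set y := (a * a)^-1.
have iy : y * (a * a) * y = y := mulVsV _.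
exists (a * y * a).
  rewrite /idempotent.
  have -> : a * y * a * (a * y * a) = a * (y * (a * a) * y) * a.
    by rewrite !mulgA.
  by rewrite iy.
rewrite !piBM -{2 3}aa -!piBM.
have -> : a * a * y * (a * a) = a * a := mulsVs _.
by rewrite piBM aa.
Qed.

Lemma quot_cI x y : x * x = x -> y * y = y -> x * y = y * x.
Proof.
move=> /quot_idem_lift[e he ->] /quot_idem_lift[f hf ->].
by rewrite -!piBM (idemC he hf).
Qed.

Lemma quot_0m x : quot_mul quot_zero x = quot_zero.
Proof. by elim/piBW: x => a; rewrite quot_mulE mul0s. Qed.

Lemma quot_m0 x : quot_mul x quot_zero = quot_zero.
Proof. by elim/piBW: x => a; rewrite quot_mulE muls0. Qed.

HB.instance Definition _ := Semigroup_isInverse.Build Q quot_vK quot_Kv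
  (sinv_unique_of_comm quot_vK quot_Kv quot_cI) quot_0m quot_m0.

End Quotient.

Section Iota.
Context {S : invSemigroupType}.
Local Notation Y0 := (spectrum (inv_closure (@set0 (idem S * {fset idem S})))).

Lemma iota_cob (s : S) :
  compact_open_bisection (germ_basic s [::] : set (germ Y0)).
Proof.
have clY : closed Y0 by exact: spectrum_closed.
have invY : invariant Y0.
  by apply: spectrum_invariant; exact: inv_closure_invariant.
split; first exact: basic_compact.
  by apply: basic_open; exists s, [::].
split=> g h /set_mem[p [-> ps _]] /set_mem[q [-> qs _]].
  by rewrite !gdomE => e; apply: pg_ext => //; rewrite ps qs.
rewrite !gcodE => e; apply: pg_ext; last by rewrite ps qs.
apply: char_ext => f.
have := congr1 (fun c : character S => c (iconj s^-1 f)) e.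
rewrite /= ps qs !iconjM.
have -> : iconj (s^-1 * s) f = imeet f (dd s).
  apply: val_inj; rewrite /= (sinv_idem (idemVM _)).
  by rewrite -mulgA (idemC (idem_valP f) (idemVM _)) [LHS]mulgA idemVM.
have hp := pg_dom p; have hq := pg_dom q; rewrite ps in hp; rewrite qs in hq.
by rewrite !charI hp hq !andbT.
Qed.

(* [iotaB s = {[s, phi] : phi(d(s)) = 1}]; no further condition is imposed. *)
Definition iotaB (s : S) : BX (@set0 (idem S * {fset idem S})) :=
  mkBX (iota_cob s).

End Iota.

(* The set X_pi of all (e, {e_1, ..., e_n}) such that pi(e) is the join of the
   pi(e_i) in E(T). *)
Definition X_pi (S T : invSemigroupType) (pi : S -> T) :
    set (idem S * {fset idem S}) :=
  [set eF | idem_join [set pi (val f) | f in [set` eF.2]] (pi (val eF.1))].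

(* The composite of [iotaB] with the quotient map. *)
Definition pi_X (S : invSemigroupType) (X : set (character S))
  (invX : invariant X) (s : S) : quotB invX := piB invX (iotaB s).

(* Isomorphism of inverse semigroups; since inverses, the order and joins are
   determined by the product, it is also isomorphism of Boolean inverse
   semigroups. *)
Definition isomorphic (T T' : invSemigroupType) : Prop :=
  exists F : {multiplicative T -> T'}, bijective F.

(* Main.v *)
From HB Require Import structures.
From mathcomp Require Import all_boot monoid finmap all_classical.
From mathcomp Require Import topology function_spaces.
Require Import Defs.

Set Implicit Arguments.
Unset Strict Implicit.
Unset Printing Implicit Defensive.
Local Open Scope classical_set_scope.

Local Open Scope group_scope.
Local Notation "x ^-1" := (sinv x) : group_scope.

(** Let [Y] be the spectrum of the relations [X_pi], and restrict each
    compact-open bisection of the universal groupoid of germs to the germs over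
    [Y]. This restriction is the isomorphism, for three reasons.

    The spectrum of [X_pi] is [X] ([spectrum_X_pi]). A pair [(e, F)] lies in [X_pi]
    exactly when [phi e] is the join of the [phi f] for all [phi] in [X] ([X_piP]),
    because idempotents of the quotient are compared over [X] only. So [X]
    satisfies [X_pi]; and as [X] is closed, a character outside [X] has a
    cylinder neighbourhood missing [X], which is a relation of [X] that this
    character violates.

    Two bisections are congruent exactly when they contain the same germs over
    [X] ([simP]), that is, when they have the same restriction. One direction
    needs an idempotent on which they agree, whose complement in each domain
    avoids [X]: the intersection of the two bisections is open but, germs being
    possibly non-Hausdorff, perhaps not compact. The part of it over [X] is
    compact, hence contained in a compact-open subset of the intersection
    ([compact_open_between]), and the sources of that subset form the idempotent.

    Restriction is multiplicative, since [X] is invariant ([germ_mul_incl]), and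
    surjective ([cob_incl_surj]). Indeed, a compact-open bisection over [X] is a
    finite union of basic ones, and each of these extends. The union of the
    extensions need not be a bisection, but conflicts between them can only
    occur away from [X], and are cut off by clopen conditions on sources and
    ranges ([glue_bisections]). *)

(** * Compact-open sets of germs *)

Section GermTopology.
Context {S : invSemigroupType} {Y : set (character S)}.
Implicit Types (s t : S) (e : idem S) (p : pregerm Y) (g h k : germ Y)
  (U V : set (germ Y)).

Lemma gdom_in g : Y (gdom g).
Proof. exact: pg_in. Qed.

Lemma gcod_in g : invariant Y -> Y (gcod g).
Proof. by move=> invY; apply: invY; exact: pg_in. Qed.

Lemma basic_val s l p : pg_elt p = s ->
  (forall t, t \in l -> ~~ pg_char p (dd t)) -> germ_basic s l (mkgerm p).
Proof. by exists p. Qed.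

Lemma basic_gdom s l g : germ_basic s l g -> gdom g (dd s).
Proof. by elim/germW: g => p /basicP[]; rewrite gdomE. Qed.

Lemma basic_gdom_neg s l t g : germ_basic s l g -> t \in l -> ~~ gdom g (dd t).
Proof. by elim/germW: g => p /basicP[_ _ h] tl; rewrite gdomE h. Qed.

Lemma basic_sub_nil s l : germ_basic s l `<=` (germ_basic s [::] : set (germ Y)).
Proof. by move=> g; elim/germW: g => p /basicP[? ? _]; apply/basicP. Qed.

Lemma basic_gcod s l g e : germ_basic s l g -> gcod g e = gdom g (iconj s e).
Proof. by move=> [p [-> <- _]]; rewrite gcodE gdomE. Qed.

(** Near a germ of [s], a coordinate of the source or of the range is the value
    of the source at an idempotent [f s]; it is [true] exactly on the germs of
    [s * f s], and [false] exactly on the germs of [s] that avoid [s * f s]. *)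
Lemma open_coordinate (c : germ Y -> bool) (f : S -> idem S) (b : bool) :
  (forall s l g, germ_basic s l g -> c g = gdom g (f s)) ->
  open [set g | c g = b].
Proof.
move=> cE; apply/germ_openP => g; elim/germW: g => p /= cp.
set s := pg_elt p.
have sp l : (forall t, t \in l -> ~~ pg_char p (dd t)) ->
    germ_basic s l (mkgerm p) by move=> h; exact: basic_val.
have cpE : c (mkgerm p) = pg_char p (f s).
  by rewrite (cE s [::]) ?gdomE//; exact: sp.
have dsf (q : pregerm Y) : germ_basic s [::] (mkgerm q) ->
    gdom (mkgerm q) (dd (s * val (f s))) = c (mkgerm q).
  by move=> sq; rewrite ddI charI (basic_gdom sq) (cE _ _ _ sq).
case: b cp => cp.
  exists (germ_basic (s * val (f s)) [::]); split.
  - by exists (s * val (f s)), [::].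
  - apply/basicP; split=> //.
      by rewrite ddI charI -cpE cp pg_dom.
    exists (f s); first by rewrite -cpE.
    by rewrite -mulgA idem_valP.
  - move=> h; elim/germW: h => q /basicP[]; rewrite ddI charI => /andP[q1 q2].
    move=> [v hv ev] _; rewrite /= (cE s [::]) ?gdomE//.
    apply/basicP; split=> //; exists (imeet (f s) v); first by rewrite charI q2.
    rewrite /= (idemC (idem_valP (f s)) (idem_valP v)) mulgA ev -!mulgA.
    congr (_ * _); rewrite mulgA (idemC (idem_valP (f s)) (idem_valP v)) -mulgA.
    by rewrite idem_valP.
exists (germ_basic s [:: s * val (f s)]); split.
- exists s, [:: s * val (f s)]; split=> // t; rewrite inE => /eqP->.
  by exists (val (f s)) => //; exact: idem_valP.
- apply: sp => t; rewrite inE => /eqP->.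
  by rewrite ddI charI -cpE cp andbF.
- move=> h; elim/germW: h => q hq /=; have := basic_gdom_neg hq (mem_head _ _).
  rewrite dsf; last exact: (basic_sub_nil hq).
  by move/negbTE.
Qed.

Lemma clopen_coordinate (c : germ Y -> bool) (f : S -> idem S) :
  (forall s l g, germ_basic s l g -> c g = gdom g (f s)) -> clopen [set g | c g].
Proof.
move=> cE; split; first exact: (open_coordinate true cE).
rewrite -openC (_ : ~` _ = [set g | c g = false]).
  exact: (open_coordinate false cE).
by apply/seteqP; split=> g /= => [/negP/negbTE//|-> ].
Qed.

Lemma clopen_gdom e : clopen [set g : germ Y | gdom g e].
Proof. exact: (clopen_coordinate (f := fun=> e)). Qed.

Lemma clopen_gcod e : clopen [set g : germ Y | gcod g e].
Proof.
by apply: (clopen_coordinate (f := fun s => iconj s e)) => s l g /basic_gcod.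
Qed.

Lemma gdom_continuous : continuous (@gdom S Y).
Proof.
move=> g.
have FF : Filter (gdom @ g) by apply: fmap_filter; exact: nbhs_filter.
apply: char_cvg => e /=.
apply: (open_nbhs_nbhs (p := g) (A := [set h : germ Y | gdom h e = gdom g e])).
by split=> //; exact: (open_coordinate (c := fun h => gdom h e) (f := fun=> e)).
Qed.

Lemma gdom_basic s l (phi : character S) :
  (gdom @` (germ_basic s l : set (germ Y))) phi <->
  [/\ Y phi, phi (dd s) & forall t, t \in l -> ~~ phi (dd t)].
Proof.
split=> [[g gB <-]|[h1 h2 h3]].
  split; [exact: gdom_in|exact: basic_gdom gB|].
  by move=> t; exact: basic_gdom_neg gB.
by exists (mkgerm (PreGerm h1 h2)); rewrite ?gdomE//; exact: basic_val.
Qed.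

(** The source set of a compact-open [U] is cut out by finitely many coordinates,
    so it pulls back to a clopen set even though [U] need not be closed: the
    space of germs can fail to be Hausdorff. *)
Lemma clopen_preimage_gdom (c : germ Y -> character S) U :
  (forall e, clopen [set g | c g e]) -> (forall g, Y (c g)) ->
  compact U -> open U -> clopen (c @^-1` (gdom @` U)).
Proof.
move=> clc Yc cU oU; have [l [hl ->]] := compact_open_basic cU oU.
elim: l hl => [|B l IH] hl.
  rewrite (_ : _ @^-1` _ = set0); first exact: clopen0.
  by rewrite -subset0 => g [h []].
have -> : c @^-1` (gdom @` [set g | exists2 C, C \in B :: l & C g]) =
    c @^-1` (gdom @` B) `|` c @^-1` (gdom @` [set g | exists2 C, C \in l & C g]).
  apply/seteqP; split=> g /=.
    move=> [h [C]]; rewrite inE => /orP[/eqP->|Cl] Ch hg; [left|right].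
      by exists h.
    by exists h => //; exists C.
  move=> [[h Bh hg]|[h [C Cl Ch] hg]]; exists h => //.
    by exists B => //; rewrite mem_head.
  by exists C => //; rewrite inE Cl orbT.
apply: clopenU; last by apply: IH => C Cl; apply: hl; rewrite inE Cl orbT.
have [s [m [_ ->]]] := hl B (mem_head _ _).
have -> : c @^-1` (gdom @` (germ_basic s m : set (germ Y))) =
    [set g | c g (dd s)] `&` [set g | forall t, t \in m -> ~~ c g (dd t)].
  apply/seteqP; split=> g; first by move/gdom_basic=> [].
  by move=> [h1 h2]; apply/gdom_basic.
apply: clopenI => //; elim: m {hl} => [|t m IHm].
  by rewrite (_ : [set g | _] = setT); [exact: clopenT|exact/seteqP].
rewrite (_ : [set g | _] = ~` [set g | c g (dd t)] `&`
    [set g | forall t, t \in m -> ~~ c g (dd t)]).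
  by apply: clopenI IHm; apply: clopenC.
apply/seteqP; split=> g /= => [h|[/negP h1 h2] u].
  by split=> [|u um]; [apply/negP|]; apply: h; rewrite inE ?eqxx ?um ?orbT.
by rewrite inE => /orP[/eqP->//|/h2].
Qed.

(** Basic open sets are compact, so a compact set has a neighbourhood basis of
    compact-open sets; the sets [W] below are directed under inclusion. *)
Lemma compact_open_between K U : closed Y -> compact K -> open U -> K `<=` U ->
  exists W : set (germ Y), [/\ compact W, open W, K `<=` W & W `<=` U].
Proof.
move=> clY /compact_near_coveringP cK /germ_openP oU KU.
pose good := [set W : set (germ Y) | [/\ compact W, open W & W `<=` U]].
pose F := filter_from good (fun W => [set W' : set (germ Y) | W `<=` W']).
have FF : Filter F.
  apply: filter_from_filter.
    by exists set0; split; [exact: compact0|exact: open0|].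
  move=> V W [cV oV sV] [cW oW sW]; exists (V `|` W).
    by split; [exact: compactU|exact: openU|move=> g [/sV|/sW]].
  by move=> W' h; split=> g hg; apply: h; [left|right].
have [|W [cW oW sW] KW] := cK _ F (fun W g => W g) FF.
  move=> g /KU/oU[B [bB Bg BU]].
  exists (B, [set W | B `<=` W]) => [|[h W] /= [Bh]]; last by apply.
  split; first exact: (open_nbhs_nbhs (conj (basic_open bB) Bg)).
  exists B => //; split=> //; last exact: basic_open.
  by have [s [l [_ ->]]] := bB; exact: basic_compact.
by exists W; split=> //; apply: KW.
Qed.

Lemma bisection_sub U V : U `<=` V -> bisection V -> bisection U.
Proof.
move=> UV [dV rV]; split=> g h /set_mem/UV Vg /set_mem/UV Vh.
  by apply: dV; exact: mem_set.
by apply: rV; exact: mem_set.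
Qed.

Lemma cobI_clopen U V : compact_open_bisection U -> clopen V ->
  compact_open_bisection (U `&` V).
Proof.
move=> [cU oU bU] [oV cV]; split; last exact: bisection_sub bU.
- exact: compact_closedI.
- exact: openI.
Qed.

Lemma comp_unitr g h k : invariant Y ->
  germ_comp h h h -> germ_comp g h k -> k = g.
Proof.
move=> invY ch c; have [x c1 c2] := compA' ch c.
rewrite -(comp_fun c c1) in c2; have [h' i] := inv_ex invY h.
exact: comp_fun (comp_Kr c2 i) (comp_Kr c i).
Qed.

End GermTopology.

Section Domains.
Context {S : invSemigroupType} {Z : set (idem S * {fset idem S})}.
Local Notation Y := (spectrum (inv_closure Z)).
Implicit Types (a e : BX Z) (g : germ Y).

Lemma spectrum_closure_invariant : invariant Y.
Proof. by apply: spectrum_invariant; exact: inv_closure_invariant. Qed.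

Let invY := spectrum_closure_invariant.

Lemma val_dom a g :
  val (a^-1 * a) g <-> germ_comp g g g /\ (gdom @` val a) (gdom g).
Proof.
split=> [h|[cg [h ah hg]]].
  split; first exact: (BX_idem_unit (idemVM a)).
  by move: h; rewrite val_BXM => -[x [k [_ ak /comp_dom[_ -> _]]]]; exists k.
have [h' i] := inv_ex invY h.
have [u c] := @comp_ex S Y h' h (inv_dom i).
have au : val (a^-1 * a) u by rewrite val_BXM; exists h', h; split=> //; exists h.
suff -> : g = u by [].
apply: (dom_inj_unit invY cg (BX_idem_unit (idemVM a) au)).
by have [_ -> _] := comp_dom c.
Qed.

Lemma val_mul_idem a e g : idempotent e ->
  val (a * e) g <-> val a g /\ (gdom @` val e) (gdom g).
Proof.
move=> he; split=> [|[ag [u eu ug]]].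
  rewrite val_BXM => -[h [u [ah eu c]]].
  have := comp_unitr invY (BX_idem_unit he eu) c => hg; subst h.
  by split=> //; exists u => //; have [_ -> _] := comp_dom c.
have cu := BX_idem_unit he eu; have [du _ _] := comp_dom cu.
have [x c] := @comp_ex S Y g u (etrans (esym ug) du).
by rewrite val_BXM; exists g, u; rewrite -{3}(comp_unitr invY cu c).
Qed.

Lemma gdom_dom a : gdom @` val (a^-1 * a) = gdom @` val a.
Proof.
apply/seteqP; split=> phi [g].
  by move=> /val_dom[_ h] <-.
move=> ag <-; have [g' i] := inv_ex invY g.
have [u c] := @comp_ex S Y g' g (inv_dom i).
exists u; last by have [_ -> _] := comp_dom c.
by rewrite val_BXM; exists g', g; split=> //; exists g.
Qed.

Lemma val_idem_gdom e g : idempotent e ->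
  val e g <-> germ_comp g g g /\ (gdom @` val e) (gdom g).
Proof. by move=> he; rewrite -{1}he -{1}(sinv_idem he) val_dom. Qed.

End Domains.

(** * Restriction to a closed invariant set of characters *)

Section Restriction.
Context {S : invSemigroupType} {Y : set (character S)}.
Local Notation Z0 := (@set0 (idem S * {fset idem S})).
Local Notation Y0 := (spectrum (inv_closure Z0)).

Lemma spectrum_set0 (phi : character S) : Y0 phi.
Proof.
move=> e F h; suff : Z0 (e, F) by [].
by apply: smallest_sub h.
Qed.

Definition germ_incl (g : germ Y) : germ Y0 :=
  mkgerm (PreGerm (spectrum_set0 _) (pg_dom (repr g))).

Implicit Types (p : pregerm Y) (g h k : germ Y) (U V : set (germ Y0)).

Lemma germ_inclE p :
  germ_incl (mkgerm p) = mkgerm (PreGerm (spectrum_set0 _) (pg_dom p)).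
Proof.
have /mkgermP[e1 e2] : mkgerm (repr (mkgerm p)) = mkgerm p := reprK _.
by apply/mkgermP.
Qed.

Lemma gdom_incl g : gdom (germ_incl g) = gdom g.
Proof. by elim/germW: g => p; rewrite germ_inclE !gdomE. Qed.

Lemma gcod_incl g : gcod (germ_incl g) = gcod g.
Proof. by elim/germW: g => p; rewrite germ_inclE !gcodE; exact: char_ext. Qed.

Lemma germ_incl_inj : injective germ_incl.
Proof.
move=> g h; elim/germW: g => p; elim/germW: h => q.
by rewrite !germ_inclE => /mkgermP[e1 e2]; apply/mkgermP.
Qed.

Lemma germ_incl_surj (g : germ Y0) : Y (gdom g) -> exists h, germ_incl h = g.
Proof.
elim/germW: g => p; rewrite gdomE => Yp; exists (mkgerm (PreGerm Yp (pg_dom p))).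
by rewrite germ_inclE; exact: pg_ext.
Qed.

Lemma comp_incl g h k :
  germ_comp g h k -> germ_comp (germ_incl g) (germ_incl h) (germ_incl k).
Proof.
elim/germW: g => p; elim/germW: h => q /comp_mkP[e ->]; rewrite !germ_inclE.
by do 3!eexists; split; [split; reflexivity|split=> //=; rewrite e; exact: char_ext].
Qed.

Lemma basic_incl s l :
  germ_incl @^-1` (germ_basic s l) = germ_basic s l.
Proof.
apply/seteqP; split=> g; elim/germW: g => p; rewrite /preimage /mkset germ_inclE.
  by move=> /basicP[? ? ?]; apply/basicP.
by move=> /basicP[h1 h2 h3]; apply/basicP.
Qed.

Lemma cob_incl U : closed Y ->
  compact_open_bisection U -> compact_open_bisection (germ_incl @^-1` U).
Proof.
move=> clY [cU oU [dU rU]].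
have [cO oO] : compact (germ_incl @^-1` U) /\ open (germ_incl @^-1` U).
  have [l [hl ->]] := compact_open_basic cU oU.
  have -> : germ_incl @^-1` [set g | exists2 B, B \in l & B g] =
      [set g | exists2 B, B \in [seq germ_incl @^-1` C | C <- l] & B g].
    apply/seteqP; split=> g /= [B]; last by move=> /mapP[C Cl ->]; exists C.
    by move=> Bl Bg; exists (germ_incl @^-1` B) => //; exact: map_f.
  apply: basic_compact_open => // _ /mapP[B /hl[s [m [hm ->]]] ->].
  by exists s, m; rewrite basic_incl.
split=> //; split=> g h /set_mem Ug /set_mem Uh e; apply: germ_incl_inj.
  by apply: dU; rewrite ?gdom_incl //; exact: mem_set.
by apply: rU; rewrite ?gcod_incl //; exact: mem_set.
Qed.

(** Invariance makes the full subgroupoid on [Y] a union of components: a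
    product that lies over [Y] has both factors over [Y]. *)
Lemma germ_mul_incl U V : invariant Y ->
  germ_incl @^-1` (germ_mul U V) =
  germ_mul (germ_incl @^-1` U) (germ_incl @^-1` V).
Proof.
move=> invY; apply/seteqP; split=> k; last first.
  by move=> [g [h [Ug Vh /comp_incl c]]]; exists (germ_incl g), (germ_incl h).
move=> [g [h [Ug Vh c]]]; have [d1 d2 _] := comp_dom c.
have Yh : Y (gdom h) by rewrite -d2 gdom_incl; exact: gdom_in.
have [h' eh] := germ_incl_surj Yh; subst h; rewrite gcod_incl in d1.
have Yg : Y (gdom g) by rewrite d1; exact: gcod_in.
have [g' eg] := germ_incl_surj Yg; subst g; rewrite gdom_incl in d1.
have [k' c'] := comp_ex d1; exists g', h'; split=> //.
by rewrite -(germ_incl_inj (comp_fun (comp_incl c') c)).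
Qed.

Lemma gdom_of_gcod (g : germ Y0) : invariant Y -> Y (gcod g) -> Y (gdom g).
Proof.
move=> invY; have [h i] := inv_ex (spectrum_closure_invariant (Z := Z0)) g.
rewrite -(inv_dom i) -(inv_cod i) => /germ_incl_surj[h' <-].
by rewrite gcod_incl; exact: gcod_in.
Qed.

(** To glue [V] to [U], discard the germs of [V] whose source or range is already
    used by [U]. Over [Y] only germs of [U] are discarded, since there the
    union is a bisection. *)
Lemma glue_bisections U V : invariant Y ->
  compact_open_bisection U -> compact_open_bisection V ->
  bisection (germ_incl @^-1` (U `|` V)) ->
  exists2 W, compact_open_bisection W &
    germ_incl @^-1` W = germ_incl @^-1` (U `|` V).
Proof.
move=> invY hU hV [dUV rUV]; have [cU oU [dU rU]] := hU.
have invY0 := spectrum_closure_invariant (Z := Z0).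
pose P : set (germ Y0) := gdom @^-1` (gdom @` U).
pose Q : set (germ Y0) := gcod @^-1` (gcod @` U).
have clP : clopen P.
  by apply: clopen_preimage_gdom => //; [exact: clopen_gdom|exact: gdom_in].
have clQ : clopen Q.
  have [cU' oU'] := inv_compact_open (@spectrum_closed S _) invY0 cU oU.
  rewrite /Q (_ : gcod @` U = gdom @` (germ_setinv U)).
    apply: clopen_preimage_gdom => //; first exact: clopen_gcod.
    by move=> g; exact: gcod_in.
  apply/seteqP; split=> phi [g Ug <-].
    by have [h i] := inv_ex invY0 g; exists h; [exists g|exact: inv_dom].
  by have [h Uh i] := Ug; exists h => //; rewrite (inv_dom i).
have [cW oW [dW rW]] : compact_open_bisection (V `&` ~` (P `|` Q)).
  by apply: cobI_clopen => //; apply: clopenC => //; exact: clopenU.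
exists (U `|` (V `&` ~` (P `|` Q))).
  split; [exact: compactU|exact: openU|].
  split=> g h /set_mem + /set_mem + e.
    move=> [Ug|Wg] [Uh|Wh].
    - by apply: dU; rewrite ?inE.
    - by exfalso; apply: Wh.2; left; exists g.
    - by exfalso; apply: Wg.2; left; exists h.
    - by apply: dW; rewrite ?inE.
  move=> [Ug|Wg] [Uh|Wh].
  - by apply: rU; rewrite ?inE.
  - by exfalso; apply: Wh.2; right; exists g.
  - by exfalso; apply: Wg.2; right; exists h.
  - by apply: rW; rewrite ?inE.
apply/seteqP; split=> g; first by move=> [?|[? _]]; [left|right].
move=> [Ug|Vg]; first by left.
have [[[u Uu ug]|[u Uu ug]]|nPQ] := pselect ((P `|` Q) (germ_incl g)).
- have [u' eu] : exists u', germ_incl u' = u.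
    by apply: germ_incl_surj; rewrite ug gdom_incl; exact: gdom_in.
  subst u; left; rewrite !gdom_incl in ug.
  by have -> : g = u' by apply: dUV => //; apply: mem_set; [right|left].
- have [u' eu] : exists u', germ_incl u' = u.
    apply/germ_incl_surj/gdom_of_gcod => //; rewrite ug gcod_incl.
    exact: gcod_in.
  subst u; left; rewrite !gcod_incl in ug.
  by have -> : g = u' by apply: rUV => //; apply: mem_set; [right|left].
- by right.
Qed.

Lemma cob_incl_surj (W : set (germ Y)) : invariant Y ->
  compact_open_bisection W ->
  exists2 U, compact_open_bisection U & germ_incl @^-1` U = W.
Proof.
move=> invY [cW oW]; have [l [hl ->]] := compact_open_basic cW oW.
elim: l hl {cW oW} => [|B l IH] hl bW.
  exists set0; first exact: set0_cob.
  by apply/esym; rewrite -subset0 => g [].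
have [s [m [hm eB]]] := hl B (mem_head _ _).
have [||U hU eU] := IH.
- by move=> C Cl; apply: hl; rewrite inE Cl orbT.
- apply: bisection_sub bW => g [C Cl Cg]; exists C => //.
  by rewrite inE Cl orbT.
have hs : compact_open_bisection (germ_basic s m : set (germ Y0)).
  have [_ _ bs] := iota_cob s.
  split; last exact: bisection_sub (@basic_sub_nil _ _ s m) bs.
  - by apply: basic_compact; exact: spectrum_closed.
  - by apply: basic_open; exists s, m.
have eUB : germ_incl @^-1` (germ_basic s m `|` U) =
    [set g | exists2 C, C \in B :: l & C g].
  rewrite preimage_setU basic_incl -eB eU; apply/seteqP; split=> g.
    move=> [Bg|[C Cl Cg]]; first by exists B; rewrite ?mem_head.
    by exists C => //; rewrite inE Cl orbT.
  by move=> [C]; rewrite inE => /orP[/eqP->|Cl] Cg; [left|right; exists C].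
have [|V hV eV] := glue_bisections invY hs hU; first by rewrite eUB.
by exists V; rewrite ?eV.
Qed.

End Restriction.

(** * The congruence as equality of germs over a closed set *)

Section Similarity.
Context {S : invSemigroupType}.
Local Notation Z0 := (@set0 (idem S * {fset idem S})).
Local Notation BS := (BX Z0).
Local Notation Y0 := (spectrum (inv_closure Z0)).
Implicit Types (a b e f : BS) (X : set (character S)) (g : germ Y0).

Let invY0 : invariant Y0. Proof. exact: spectrum_closure_invariant. Qed.

(** A compact-open part [W] of [a] gives the idempotent [e] of its sources; what
    is left of [d(a)] is the idempotent [f]. *)
Lemma dom_split a (W : set (germ Y0)) : compact W -> open W -> W `<=` val a ->
  exists e f : BS, [/\ idempotent e /\ idempotent f,
    idem_join [set e; f] (a^-1 * a),
    gdom @` val e = gdom @` W,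
    gdom @` val f = gdom @` val a `\` gdom @` W & val (a * e) = W].
Proof.
move=> cW oW sW; have ha := BXP a; have [_ _ [da ra]] := ha.
have hW : compact_open_bisection W.
  by split=> //; apply: bisection_sub sW _; split.
have clW : clopen (gdom @^-1` (gdom @` W) : set (germ Y0)).
  by apply: clopen_preimage_gdom => //; [exact: clopen_gdom|exact: gdom_in].
have hV : compact_open_bisection (val a `&` ~` (gdom @^-1` (gdom @` W))).
  by apply: cobI_clopen => //; exact: clopenC.
pose w : BS := mkBX hW; pose v : BS := mkBX hV.
have ew : gdom @` val (w^-1 * w) = gdom @` W by rewrite gdom_dom.
have ev : gdom @` val (v^-1 * v) = gdom @` val a `\` gdom @` W.
  rewrite gdom_dom; apply/seteqP; split=> phi.
    by move=> [g [ag nW] <-]; split; [exists g|].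
  by move=> [[g ag <-] nW]; exists g.
exists (w^-1 * w), (v^-1 * v); split=> //.
- by split; exact: idemVM.
- apply/idem_joinP; try exact: idemVM.
  apply/seteqP; split=> g.
    move=> /val_dom[cg adg].
    have [Wg|nWg] := pselect ((gdom @` W) (gdom g)); [left|right]; apply/val_dom.
      by split.
    by split=> //; rewrite -gdom_dom ev.
  move=> [] /val_dom[cg]; rewrite -gdom_dom ?ew ?ev => h; apply/val_dom.
    by split=> //; have [k /sW ak <-] := h; exists k.
  by split=> //; have [] := h.
- apply/seteqP; split=> g.
    move=> /(val_mul_idem _ _ (idemVM w))[ag]; rewrite ew => -[k Wk kg].
    by rewrite -(da _ _ (mem_set (sW _ Wk)) (mem_set ag) kg).
  move=> Wg; apply/(val_mul_idem _ _ (idemVM w)); split; first exact: sW.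
  by rewrite ew; exists g.
Qed.

(** The set [val a `&` val b] may fail to be compact, but the part of [a] over
    the closed set [X] is compact and lies in it, hence so does a compact-open
    set between the two; its sources witness the congruence. *)
Lemma simP X a b : closed X ->
  sim X a b <-> (forall g, X (gdom g) -> val a g <-> val b g).
Proof.
move=> clX; split.
  suff half a' b' : sim X a' b' -> forall g, X (gdom g) -> val a' g -> val b' g.
    by move=> ab g Xg; split; apply: half Xg => //; exact: sim_sym.
  move=> [e [f [g' [[he ja _] [If _ ab]]]]] g Xg ag.
  have : (gdom @` val (a'^-1 * a')) (gdom g) by rewrite gdom_dom; exists g.
  have /(idem_joinP _ he If.1) -> := ja.
  move=> [u [eu|fu] ug]; last first.
    by exfalso; apply: (ideal_notin If fu); rewrite ug.
  have : val (a' * e) g by apply/val_mul_idem => //; split=> //; exists u.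
  by rewrite ab => /(val_mul_idem _ _ he)[].
move=> ab; have [ca oa [da ra]] := BXP a; have [cb ob [db rb]] := BXP b.
pose K : set (germ Y0) := val a `&` gdom @^-1` X.
have cK : compact K.
  apply: compact_closedI => //; apply: preimage_closed => // g _.
  exact: gdom_continuous.
have [|W [cW oW KW sW]] :=
    compact_open_between (@spectrum_closed S _) cK (openI oa ob).
  by move=> g [ag Xg]; split=> //; apply/ab.
have [e [f [[he hf] ja de df ae]]] := dom_split cW oW (fun g Wg => (sW g Wg).1).
have [e' [f' [[he' hf'] jb de' df' be]]] :=
  dom_split cW oW (fun g Wg => (sW g Wg).2).
have ee : e' = e.
  apply: val_inj; apply/seteqP; split=> g /val_idem_gdom.
    by move=> /(_ he')[? ?]; apply/val_idem_gdom => //; rewrite de -de'.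
  by move=> /(_ he)[? ?]; apply/val_idem_gdom => //; rewrite de' -de.
subst e'; exists e, f, f'; split; split=> //; last first.
- by apply: val_inj; rewrite ae be.
- apply: idealP => // g f'g Xg.
  have : (gdom @` val f') (gdom g) by exists g.
  rewrite df' => -[[h bh hg] []]; exists h => //.
  by apply: KW; split; rewrite /preimage /mkset ?hg//; apply/ab => //; rewrite hg.
- apply: idealP => // g fg Xg.
  have : (gdom @` val f) (gdom g) by exists g.
  rewrite df => -[[h ah hg] []]; exists h => //.
  by apply: KW; split; rewrite /preimage /mkset ?hg.
Qed.

End Similarity.

(** * The closed set is the spectrum of its relations *)

(** The cylinders at [phi] generate a filter that converges to [phi]. *)
Lemma char_nbhs_sub (S : invSemigroupType) (phi : character S) A :
  nbhs phi A -> exists l : seq (idem S),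
    [set psi : character S | forall e, e \in l -> psi e = phi e] `<=` A.
Proof.
pose C (l : seq (idem S)) :=
  [set psi : character S | forall e, e \in l -> psi e = phi e].
pose F := filter_from setT C.
have FF : Filter F.
  apply: filter_from_filter; first by exists [::].
  move=> l m _ _; exists (l ++ m) => // psi h; split=> e el; apply: h;
  by rewrite mem_cat el ?orbT.
have Fphi : F --> phi.
  apply: char_cvg => e; exists [:: e] => // psi /= h.
  by apply: h; exact: mem_head.
by move=> /Fphi[l _ lA]; exists l.
Qed.

Section SpectrumOfX.
Context {S : invSemigroupType} {X : set (character S)}.
Hypotheses (clX : closed X) (invX : invariant X).
Local Notation Z0 := (@set0 (idem S * {fset idem S})).
Local Notation BS := (BX Z0).
Local Notation Y0 := (spectrum (inv_closure Z0)).
Local Notation Xpi := (X_pi (pi_X invX)).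
Implicit Types (a b : BS) (e f : idem S) (phi : character S) (g : germ Y0).

Lemma piB_idem a : idempotent a -> idempotent (piB invX a).
Proof. by move=> ha; rewrite /idempotent -piBM ha. Qed.

Lemma nle_piB a b : idempotent a -> idempotent b ->
  nle (piB invX a) (piB invX b) <->
  X `&` gdom @` val a `<=` gdom @` val b.
Proof.
move=> ha hb; rewrite idem_nle; [|exact: piB_idem|exact: piB_idem].
rewrite -piBM piBP simP// (idemC hb ha); split=> [h phi [Xphi [g ag gphi]]|h g Xg].
  subst phi; have /(h g Xphi)/(val_mul_idem _ _ hb)[] := ag.
  by [].
split=> [ag|/(val_mul_idem _ _ hb)[]//].
by apply/val_mul_idem => //; split=> //; apply: h; split=> //; exists g.
Qed.

Lemma germ_val_unit e p : pg_elt p = val e -> pg_char p e ->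
  germ_comp (mkgerm p) (mkgerm p) (mkgerm p : germ Y0).
Proof.
move=> pe ep; exists p, p, p; split=> //; split=> //; last first.
  by rewrite pe idem_valP.
apply: char_ext => f /=; rewrite pe.
have -> : iconj (val e) f = imeet e (imeet f e).
  by apply: val_inj; rewrite /= (sinv_idem (idem_valP e)) mulgA.
by rewrite !charI ep andbT.
Qed.

Lemma dd_val e : dd (val e) = e.
Proof.
by apply: val_inj; rewrite /= (sinv_idem (idem_valP e)) idem_valP.
Qed.

Lemma iotaB_idem e : idempotent (iotaB (val e)).
Proof.
apply: unit_idem => g [p [-> pe _]]; apply: (germ_val_unit pe).
by rewrite -(dd_val e) -pe pg_dom.
Qed.

Lemma gdom_iotaB e : gdom @` val (iotaB (val e)) =
  [set phi : character S | phi e].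
Proof.
apply/seteqP; split=> phi.
  by move=> /gdom_basic[_]; rewrite dd_val.
by move=> he; apply/gdom_basic; split; [exact: spectrum_set0|rewrite dd_val|].
Qed.

Lemma X_piP e (F : {fset idem S}) :
  Xpi (e, F) <-> (forall phi, X phi -> phi e = has phi F).
Proof.
have hpi f : idempotent (pi_X invX (val f)) by exact/piB_idem/iotaB_idem.
have pi_le f a : idempotent a -> nle (pi_X invX (val f)) (piB invX a) <->
    (forall phi, X phi -> phi f -> (gdom @` val a) phi).
  move=> ha; rewrite nle_piB//; last exact: iotaB_idem.
  rewrite gdom_iotaB; split=> h phi.
    by move=> Xphi fphi; apply: h.
  by move=> []; exact: h.
split=> [[/= _ hub hlub] phi Xphi|h].
  apply/idP/hasP => [ephi|[f fF fphi]]; last first.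
    have /pi_le : nle (pi_X invX (val f)) (pi_X invX (val e)).
      by apply: hub; exists f.
    move=> /(_ (iotaB_idem e) phi Xphi fphi).
    by rewrite gdom_iotaB.
  pose l := [seq (germ_basic (val f) [::] : set (germ Y0)) | f <- F].
  have hl B : B \in l -> is_basic B by move=> /mapP[f _ ->]; exists (val f), [::].
  have ul g : [set g | exists2 B, B \in l & B g] g -> germ_comp g g g.
    move=> [_ /mapP[f _ ->] gf].
    exact: (BX_idem_unit (iotaB_idem f) gf).
  have [cU oU] := basic_compact_open (@spectrum_closed S _) hl.
  have hU : compact_open_bisection [set g | exists2 B, B \in l & B g].
    split=> //; apply: units_bisection ul; exact: spectrum_closure_invariant.
  pose u : BS := mkBX hU.
  have hu : idempotent u by exact: unit_idem.
  have /pi_le : nle (pi_X invX (val e)) (piB invX u).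
    apply: hlub; first exact: piB_idem.
    move=> _ [f fF <-]; apply/pi_le => // psi _ fpsi.
    have : (gdom @` val (iotaB (val f))) psi by rewrite gdom_iotaB.
    move=> [g gf <-]; exists g => //; exists (germ_basic (val f) [::]) => //.
    exact: map_f.
  move=> /(_ hu phi Xphi ephi)[g [_ /mapP[f fF ->] gf] <-].
  by exists f => //; rewrite -(dd_val f); exact: basic_gdom gf.
split=> [||y hy hF] /=; first exact: hpi.
  move=> _ [f fF <-]; apply/pi_le; first exact: iotaB_idem.
  move=> phi Xphi fphi; rewrite gdom_iotaB /= h//.
  by apply/hasP; exists f.
have [b hb yb] := quot_idem_lift hy; subst y.
apply/pi_le => // phi Xphi; rewrite h// => /hasP[f fF fphi].
have /pi_le : nle (pi_X invX (val f)) (piB invX b) by apply: hF; exists f.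
exact.
Qed.

Lemma X_pi_invariant : S_invariant Xpi.
Proof.
move=> e F /X_piP h s; apply/X_piP => phi Xphi.
have -> : has phi [fset iconj s f | f in F]%fset = has (phi \o iconj s) F.
  apply/hasP/hasP => [[_ /imfsetP[f /= fF ->] hf]|[f fF hf]]; first by exists f.
  by exists (iconj s f) => //; apply/imfsetP; exists f.
have [hs|ns] := boolP (phi (dd s)).
  exact: (h (act hs) (invX hs Xphi)).
have n0 f : phi (iconj s f) = false.
  apply/negbTE; apply: contra ns.
  have -> : iconj s f = imeet (iconj s f) (dd s).
    by apply: val_inj; rewrite /= -!mulgA [s * (_ * _)]mulgA mulsVs.
  by rewrite charI => /andP[].
by rewrite n0; apply/esym/hasP => -[f _]; rewrite /= n0.
Qed.

(** Outside the closed set [X], a character has a neighbourhood missing [X]; it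
    can be taken of the form [psi e = 1], [psi f = 0] for [f] in [F] with each [f]
    below [e], and then [(e, F)] is a relation of [X] that it violates. *)
Lemma spectrum_X_pi : spectrum (inv_closure Xpi) = X.
Proof.
apply/seteqP; split=> phi; last first.
  move=> Xphi e F /(smallest_sub X_pi_invariant (@subset_refl _ _))/X_piP h.
  by rewrite big_orb_has h.
move=> sphi; apply: clX => A /char_nbhs_sub[l lA]; apply: contrapT => nA.
have [e0 he0] := char_neq0 phi.
pose e := foldr imeet e0 [seq x <- l | phi x].
pose F := [fset imeet e x | x in [seq x <- l | ~~ phi x]]%fset.
have eP (psi : character S) :
    psi e = psi e0 && all psi [seq x <- l | phi x].
  rewrite /e; elim: [seq x <- l | phi x] => [|x r IH] /=; first by rewrite andbT.
  by rewrite charI IH andbCA.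
have ephi : phi e.
  by rewrite eP he0; apply/allP => x; rewrite mem_filter => /andP[].
have FP (psi : character S) : has psi F = psi e && has psi [seq x <- l | ~~ phi x].
  apply/hasP/andP => [[_ /imfsetP[x /= xl ->]]|[pe /hasP[x xl px]]].
    by rewrite charI => /andP[-> px]; split=> //; apply/hasP; exists x.
  exists (imeet e x); last by rewrite charI pe.
  by apply/imfsetP; exists x.
have XeF : Xpi (e, F).
  apply/X_piP => psi Xpsi; rewrite FP; case pe : (psi e) => //=.
  apply/esym/negPn/negP => /hasPn npsi; apply: nA; exists psi; split=> //.
  apply: lA => x xl; have [px|npx] := boolP (phi x).
    move: pe; rewrite eP => /andP[_ /allP]; apply.
    by rewrite mem_filter px.
  by apply/negbTE/npsi; rewrite mem_filter npx.
have := sphi _ _ (sub_gen_smallest XeF).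
rewrite big_orb_has FP ephi /= => /esym/hasP[x].
by rewrite mem_filter => /andP[/negP].
Qed.

End SpectrumOfX.

(** * The isomorphism *)

Theorem theorem6p1 (S : invSemigroupType) (X : set (character S))
  (clX : closed X) (invX : invariant X) :
  isomorphic (quotB invX) (BX (X_pi (pi_X invX))).
Proof.
set Z := X_pi _; set Y := spectrum (inv_closure Z).
have YX : Y = X := spectrum_X_pi clX invX.
have clY : closed Y by exact: spectrum_closed.
have invY : invariant Y by exact: spectrum_closure_invariant.
pose res (a : BX set0) : BX Z := mkBX (cob_incl clY (BXP a)).
have resM a b : res (a * b) = res a * res b.
  by apply: val_inj; exact: germ_mul_incl.
have resP a b : res a = res b <-> sim X a b.
  rewrite simP//; split=> [ab g|ab].
    rewrite -YX => /germ_incl_surj[h <-].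
    have := congr1 (fun c : BX Z => val c h) ab.
    by rewrite /= /preimage /mkset => ->.
  have Xin (g : germ Y) : X (gdom (germ_incl g)).
    by rewrite gdom_incl -YX; exact: gdom_in.
  by apply: val_inj; apply/seteqP; split=> g; apply ab.
have res_surj c : exists a, res a = c.
  have [U hU eU] := cob_incl_surj invY (BXP c).
  by exists (mkBX hU); apply: val_inj.
pose F (x : quotB invX) : BX Z := res (repr x).
have FE a : F (piB invX a) = res a.
  by apply/resP/(piBP invX); exact: reprK.
have FM : {morph F : x y / x * y}.
  apply: (piBW (invX := invX)) => a; apply: (piBW (invX := invX)) => b.
  by rewrite -piBM !FE resM.
pose mF := isMultiplicative.Build _ _ F FM.
pose G : {multiplicative quotB invX -> BX Z} := HB.pack F mF.
exists G; have [H HK] := choice res_surj.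
exists (fun c => piB invX (H c)) => [|c].
  by apply: (piBW (invX := invX)) => a; apply/piBP/resP; rewrite HK; exact: FE.
by rewrite [LHS]FE.
Qed.
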